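(* Let $\Gamma$ be a strict Lie 2-group such that the corresponding strict Lie 2-algebra is a quadratic strict Lie 2-algebra $(\mathfrak h^*[1]\oplus\mathfrak h;\mathfrak l_1,\mathfrak l_2,\mathcal S)$, and let $(A,B)$ be a $\Gamma$-connection on a manifold $M$. Consider the associated quadratic Lie 2-algebroid $((M\times\mathfrak h^* )\oplus(TM\oplus(M\times\mathfrak h));\mathrm{pr}_{TM},l_1,l_2,l_3)$, with $$l_1(m)=\mathfrak l_1(m),\qquad l_2(X+u,m)=L_Xm+\mathfrak l_2(A(X),m)+\mathfrak l_2(u,m),$$ $$l_2(X+u,Y+v)=[X,Y]+L_Xv+\mathfrak l_2(A(X),v)-L_Yu-\mathfrak l_2(A(Y),u)+\mathrm{fcurv}(A,B)(X,Y)+\mathfrak l_2(u,v),$$ $$l_3(X+u,Y+v,Z+w)=-\mathrm{curv}(A,B)(X,Y,Z)+\mathfrak l_2(B(X,Y),w)+\mathfrak l_2(B(Y,Z),u)+\mathfrak l_2(B(Z,X),v)$$ for $X,Y,Z\in\mathfrak X(M)$, $u,v,w\in\Gamma(M\times\mathfrak h)$, $m\in\Gamma(M\times\mathfrak h^* )$. Then its first Pontryagin class in $H^5(M)$, which is represented by the 5-cocycle $-\mathcal S(\mathrm{fcurv}(A,B),\mathrm{curv}(A,B))$, is trivial.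
   Context: A strict Lie 2-group $\Gamma$ corresponds to a crossed module of Lie groups $(H_1,H_0,\Psi,\Phi)$: a Lie group morphism $\Psi:H_1\to H_0$ and an action $\Phi$ of $H_0$ on $H_1$ by automorphisms with $\Psi(\Phi_g(h))=g\Psi(h)g^{-1}$, $\Phi_{\Psi(h)}(h')=hh'h^{-1}$. Its infinitesimal version is a crossed module of Lie algebras $(\mathfrak h_1,\mathfrak h_0,\psi,\phi)$ and the corresponding strict Lie 2-algebra $(\mathfrak h_1\oplus\mathfrak h_0;\mathfrak l_1,\mathfrak l_2)$ has $\mathfrak h_1$ in degree $-1$, $\mathfrak l_1=\psi$, $\mathfrak l_2(u,v)=[u,v]_{\mathfrak h_0}$, $\mathfrak l_2(u,m)=-\mathfrak l_2(m,u)=\phi_u(m)$. It is quadratic if there is a nondegenerate graded symmetric pairing $\mathcal S$ between $\mathfrak h_1$ and $\mathfrak h_0$ (zero on $\mathfrak h_1\times\mathfrak h_1$ and $\mathfrak h_0\times\mathfrak h_0$) with $\mathcal S(\mathfrak l_1(m),p)=\mathcal S(m,\mathfrak l_1(p))$ and $\mathcal S(\mathfrak l_2(u,v),m)=-\mathcal S(v,\mathfrak l_2(u,m))$; then one writes $\mathfrak h_0=\mathfrak h$, $\mathfrak h_1=\mathfrak h^*[1]$, with $\mathcal S$ the canonical pairing. A $\Gamma$-connection is a pair $A\in\Omega^1(M,\mathfrak h_0)$, $B\in\Omega^2(M,\mathfrak h_1)$; $\mathrm{curv}(A,B)=dB+\mathfrak l_2(A,B)$, $\mathrm{fcurv}(A,B)=dA+\frac12\mathfrak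 l_2(A,A)-\mathfrak l_1(B)$, with $\mathfrak l_2(A,A)(X,Y)=2\mathfrak l_2(A(X),A(Y))$ and $\mathfrak l_2(A,B)(X,Y,Z)=\mathfrak l_2(A(X),B(Y,Z))+\mathfrak l_2(A(Y),B(Z,X))+\mathfrak l_2(A(Z),B(X,Y))$. $L_X$ is the derivative of vector-valued functions. For an $\mathfrak h_0$-valued $k$-form $\Xi$ and an $\mathfrak h_1$-valued $l$-form $\Pi$, $\mathcal S(\Xi,\Pi)(X_1,\dots,X_{k+l})=\frac1{k!l!}\sum_{\tau\in S_{k+l}}\mathrm{sgn}(\tau)\mathcal S(\Xi(X_{\tau(1)},\dots,X_{\tau(k)}),\Pi(X_{\tau(k+1)},\dots,X_{\tau(k+l)}))$. Lie 2-algebra $(V_{-1}\oplus V_0;l_1,l_2,l_3)$: linear $l_1:V_{-1}\to V_0$; bilinear $l_2$, skew-symmetric on $V_0$, $l_2(x,m)=-l_2(m,x)\in V_{-1}$, zero on $V_{-1}\times V_{-1}$; totally skew-symmetric $l_3:V_0^3\to V_{-1}$; such that $l_1l_2(x,m)=l_2(x,l_1m)$; $l_2(l_1m,n)=l_2(m,l_1n)$; $l_1l_3(x,y,z)=l_2(x,l_2(y,z))-l_2(l_2(x,y),z)-l_2(y,l_2(x,z))$; $l_3(x,y,l_1m)=l_2(x,l_2(y,m))-l_2(l_2(x,y),m)-l_2(y,l_2(x,m))$; $l_2(w,l_3(x,y,z))-l_2(x,l_3(w,y,z))+l_2(y,l_3(w,x,z))+l_2(l_3(w,x,y),z)-l_3(l_2(w,x),y,z)-l_3(x,l_2(w,y),z)-l_3(x,y,l_2(w,z))+l_3(w,l_2(x,y),z)+l_3(w,y,l_2(x,z))-l_3(w,x,l_2(y,z))=0$.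 A transitive Lie 2-algebroid: graded vector bundle $A_{-1}\oplus A_0$ with surjective anchor $\rho:A_0\to TM$ and a Lie 2-algebra structure $(l_1,l_2,l_3)$ on sections, $l_1,l_3$ $C^\infty(M)$-linear, $l_2(X^0,fY)=fl_2(X^0,Y)+\rho(X^0)(f)Y$. It is quadratic if there is a degree 1 nondegenerate graded symmetric form $\mathcal S$ on $A_{-1}\oplus\ker\rho$ with $\mathcal S(l_1m,p)=\mathcal S(m,l_1p)$, $\rho(e^0)\mathcal S(u,m)=\mathcal S(l_2(e^0,u),m)+\mathcal S(u,l_2(e^0,m))$, $\mathcal S(l_3(e^0_1,e^0_2,u),v)=-\mathcal S(l_3(e^0_1,e^0_2,v),u)$. Its first Pontryagin class is $[\mathcal S(R_\gamma,I_\gamma)]\in H^5(M)$ where, for any $\sigma:TM\to A_0$ with $\rho\sigma=\mathrm{id}$ and $\gamma:\wedge^2TM\to A_{-1}$, $\nabla^1_Xm=l_2(\sigma(X),m)$, $R(X,Y)=\sigma[X,Y]-l_2(\sigma(X),\sigma(Y))-l_1\gamma(X,Y)$, $I(X,Y,Z)=-d_{\nabla^1}\gamma(X,Y,Z)-l_3(\sigma(X),\sigma(Y),\sigma(Z))$, $R_\gamma=R+l_1\circ\gamma$, $I_\gamma=I+d_{\nabla^1}\gamma$ (the class is independent of $\sigma,\gamma$). *)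

(* Defs.v *)
From HB Require Import structures.
From mathcomp Require Import all_boot all_order all_fingroup all_algebra.
From mathcomp Require Import ring.
From mathcomp Require Import all_classical all_reals all_analysis.

Set Implicit Arguments.
Unset Strict Implicit.
Unset Printing Implicit Defensive.

Import Order.TTheory GRing.Theory Num.Theory numFieldNormedType.Exports.
Local Open Scope classical_set_scope.
Local Open Scope ring_scope.

Section Smooth.
Variables (R : realType) (V : normedModType R).
Implicit Types (U : set V) (f g : V -> R).

(* C^k regularity on the open set [U], [V] being finite dimensional in all uses:
   directional derivatives of order at most [k] exist and are continuous. *)
Fixpoint Ck_on (k : nat) U f : Prop :=
  match k with
  | 0 => forall x, U x -> {for x, continuous f}
  | k'.+1 => (forall x, U x -> {for x, continuous f}) /\
      forall v, (forall x, U x -> derivable f x v) /\ Ck_on k' U ('D_v f)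
  end.

Definition smooth_on U f := forall k, Ck_on k U f.

Lemma Ck_on_cont k U f x : Ck_on k U f -> U x -> {for x, continuous f}.
Proof. by case: k => [|k] /= => [h|[h _]]; exact: h. Qed.

Lemma Ck_on_le k U f : Ck_on k.+1 U f -> Ck_on k U f.
Proof.
elim: k f => [|k IHk] f [cf df]; first exact: cf.
by split=> // v; have [dv /IHk] := df v.
Qed.

Lemma eq_Ck_on k U f g : open U -> (forall x, U x -> f x = g x) ->
  Ck_on k U f -> Ck_on k U g.
Proof.
move=> oU; have near_eq f' g' : (forall x, U x -> f' x = g' x) ->
    forall x, U x -> \near x, f' x = g' x.
  move=> e x Ux; near=> y; apply: e; near: y; exact: open_nbhs_nbhs.
have cont_eq f' g' : (forall x, U x -> f' x = g' x) -> forall x, U x ->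
    {for x, continuous f'} -> {for x, continuous g'}.
  move=> e x Ux cf; rewrite /prop_for /continuous_at -(e x Ux).
  by apply: cvg_trans cf; apply: near_eq_cvg; exact: (near_eq _ _ e).
elim: k f g => [|k IHk] f g e /=.
  by move=> cf x Ux; apply: (cont_eq _ _ e) => //; exact: cf.
move=> [cf df]; split.
  by move=> x Ux; apply: (cont_eq _ _ e) => //; exact: cf.
move=> v; have [dv cdv] := df v; split.
  by move=> x Ux; apply: near_eq_derivable (dv x Ux); exact: (near_eq _ _ e).
apply: IHk cdv => x Ux; apply: near_eq_derive; exact: (near_eq _ _ e).
Unshelve. all: by end_near. Qed.

Lemma Ck_on_cst k U (a : R) : Ck_on k U (cst a).
Proof.
elim: k a => [|k IHk] a /=; first by move=> x _; exact: cst_continuous.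
split=> [x _|v]; first exact: cst_continuous.
split=> [x _|]; first exact: derivable_cst.
rewrite (_ : 'D_v (cst a) = cst 0) //.
by apply/funext => x; rewrite derive_cst.
Qed.

Lemma Ck_onD k U f g : open U -> Ck_on k U f -> Ck_on k U g ->
  Ck_on k U (f \+ g).
Proof.
move=> oU; elim: k f g => [|k IHk] f g /=.
  by move=> cf cg x Ux; apply: cvgD; [exact: cf|exact: cg].
move=> [cf df] [cg dg]; split.
  by move=> x Ux; apply: cvgD; [exact: cf|exact: cg].
move=> v; have [dfv Cfv] := df v; have [dgv Cgv] := dg v; split.
  by move=> x Ux; apply: derivableD; [exact: dfv|exact: dgv].
apply: (eq_Ck_on oU _ (IHk _ _ Cfv Cgv)) => x Ux /=.
by rewrite -deriveD //; [exact: dfv|exact: dgv].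
Qed.

Lemma Ck_onM k U f g : open U -> Ck_on k U f -> Ck_on k U g ->
  Ck_on k U (f \* g).
Proof.
move=> oU; elim: k f g => [|k IHk] f g.
  by move=> cf cg x Ux; apply: cvgM; [exact: cf|exact: cg].
move=> Cf Cg; have [cf df] := Cf; have [cg dg] := Cg; split.
  by move=> x Ux; apply: cvgM; [exact: cf|exact: cg].
move=> v; have [dfv Cfv] := df v; have [dgv Cgv] := dg v; split.
  by move=> x Ux; apply: derivableM; [exact: dfv|exact: dgv].
have C1 := IHk _ _ (Ck_on_le Cf) Cgv.
have C2 := IHk _ _ (Ck_on_le Cg) Cfv.
apply: (eq_Ck_on oU _ (Ck_onD oU C1 C2)) => x Ux /=.
by rewrite [RHS]deriveM //; [exact: dfv|exact: dgv].
Qed.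

End Smooth.

Section Manifolds.
Variable R : realType.

Record chart (M : topologicalType) (n : nat) := Chart {
  chart_dom : set M;
  chart_to : M -> 'rV[R]_n;
  chart_of : 'rV[R]_n -> M;
  chart_dom_open : open chart_dom;
  chart_img_open : open (chart_to @` chart_dom);
  chart_to_cont : forall x, chart_dom x -> {for x, continuous chart_to};
  chart_of_cont : forall v, (chart_to @` chart_dom) v ->
    {for v, continuous chart_of};
  chart_toK : forall x, chart_dom x -> chart_of (chart_to x) = x }.

Definition smooth_rV_on (V : normedModType R) n (U : set V) (F : V -> 'rV[R]_n) :=
  forall j, smooth_on U (fun v => F v 0 j).

Record manifold := Manifold {
  mfd_sort :> topologicalType;
  mfd_dim : nat;
  mfd_atlas : set (chart mfd_sort mfd_dim);
  mfd_hausdorff : hausdorff_space mfd_sort;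
  mfd_second_countable : @second_countable mfd_sort;
  mfd_cover : forall x, exists2 c, mfd_atlas c & chart_dom c x;
  mfd_compat : forall c c', mfd_atlas c -> mfd_atlas c' ->
    smooth_rV_on (chart_to c @` (chart_dom c `&` chart_dom c'))
                 (chart_to c' \o chart_of c) }.

Definition smooth_map (M N : manifold) (F : M -> N) : Prop :=
  continuous F /\
  forall c c', @mfd_atlas M c -> @mfd_atlas N c' ->
    smooth_rV_on (chart_to c @` (chart_dom c `&` F @^-1` chart_dom c'))
                 (chart_to c' \o F \o chart_of c).

(* Smoothness of a map on the product manifold [M * N], read in the product
   charts. *)
Definition smooth_map2 (M N P : manifold) (F : M -> N -> P) : Prop :=
  continuous (fun xy : M * N => F xy.1 xy.2) /\
  forall c1 c2 c3,
    @mfd_atlas M c1 -> @mfd_atlas N c2 -> @mfd_atlas P c3 ->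
    smooth_rV_on
      ((fun xy : M * N => (chart_to c1 xy.1, chart_to c2 xy.2)) @`
        [set xy | [/\ chart_dom c1 xy.1, chart_dom c2 xy.2
                    & chart_dom c3 (F xy.1 xy.2)]])
      (fun ab : 'rV[R]_(mfd_dim M) * 'rV[R]_(mfd_dim N) =>
        chart_to c3 (F (chart_of c1 ab.1) (chart_of c2 ab.2))).

Section SmoothFunctions.
Variable M : manifold.

Definition is_smooth (f : M -> R) : Prop :=
  forall c, @mfd_atlas M c ->
    smooth_on (chart_to c @` chart_dom c) (f \o chart_of c).

Lemma is_smooth_cst a : is_smooth (cst a).
Proof. by move=> c _ k; exact: Ck_on_cst. Qed.

Lemma is_smoothD f g : is_smooth f -> is_smooth g -> is_smooth (f \+ g).
Proof.
move=> sf sg c Mc k.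
exact: (Ck_onD (@chart_img_open _ _ c) (sf c Mc k) (sg c Mc k)).
Qed.

Lemma is_smoothM f g : is_smooth f -> is_smooth g -> is_smooth (f \* g).
Proof.
move=> sf sg c Mc k.
exact: (Ck_onM (@chart_img_open _ _ c) (sf c Mc k) (sg c Mc k)).
Qed.

Lemma is_smoothN f : is_smooth f -> is_smooth (\- f).
Proof.
move=> /(is_smoothM (is_smooth_cst (-1))); congr is_smooth.
by apply/funext => x /=; rewrite mulN1r.
Qed.

Lemma is_smooth_sum I (r : seq I) (P : pred I) (f : I -> M -> R) :
  (forall i, P i -> is_smooth (f i)) ->
  is_smooth (fun x => \sum_(i <- r | P i) f i x).
Proof.
move=> sf; elim: r => [|i r IHr].
  rewrite (_ : (fun _ => _) = cst 0); first exact: is_smooth_cst.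
  by apply/funext => x; rewrite big_nil.
case: (boolP (P i)) => Pi.
  rewrite (_ : (fun _ => _) =
    f i \+ (fun x => \sum_(i <- r | P i) f i x)).
    by apply: is_smoothD => //; exact: sf.
  by apply/funext => x /=; rewrite big_cons Pi.
congr is_smooth: IHr.
by apply/funext => x; rewrite big_cons (negbTE Pi).
Qed.

Definition smooth_pred : {pred M -> R} := fun f => `[< is_smooth f >].

Lemma smooth_subring_closed : subring_closed smooth_pred.
Proof.
split; first by apply/asboolP; exact: is_smooth_cst.
- move=> f g /asboolP sf /asboolP sg; apply/asboolP.
  by apply: is_smoothD => //; exact: is_smoothN.
- by move=> f g /asboolP sf /asboolP sg; apply/asboolP; exact: is_smoothM.
Qed.

HB.instance Definition _ :=
  GRing.isSubringClosed.Build (M -> R) smooth_pred smooth_subring_closed.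

Record smoothFun := SmoothFun {
  smoothFun_val :> M -> R;
  smoothFunP : smoothFun_val \in smooth_pred }.

HB.instance Definition _ := [isSub for smoothFun_val].
HB.instance Definition _ := [Choice of smoothFun by <:].
HB.instance Definition _ := GRing.SubChoice_isSubComPzRing.Build (M -> R) smooth_pred
  smoothFun smooth_subring_closed.

Definition scst (a : R) : smoothFun := SmoothFun (asboolT (is_smooth_cst a)).

(* [f] seen as an element of C^oo(M); only used when [f] is smooth. *)
Definition to_smooth (f : M -> R) : smoothFun := insubd 0 f.

End SmoothFunctions.

Section SmoothSections.
Variables (M : manifold) (V : vectType R).

Definition is_smooth_sec (s : M -> V) : Prop :=
  forall i, is_smooth (fun x => coord (vbasis {:V}) i (s x)).

Definition smooth_sec_pred : {pred M -> V} := fun s => `[< is_smooth_sec s >].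

Lemma smooth_sec_zmod_closed : zmod_closed smooth_sec_pred.
Proof.
split.
  apply/asboolP => i; rewrite (_ : (fun _ => _) = cst 0).
    exact: is_smooth_cst.
  by apply/funext => x; rewrite linear0.
move=> s t /asboolP ss /asboolP st; apply/asboolP => i.
rewrite (_ : (fun _ => _) = (fun x => coord (vbasis {:V}) i (s x)) \+
   (\- (fun x => coord (vbasis {:V}) i (t x)))).
  by apply: is_smoothD; [exact: ss|apply: is_smoothN; exact: st].
by apply/funext => x /=; rewrite -linearB.
Qed.

HB.instance Definition _ :=
  GRing.isZmodClosed.Build (M -> V) smooth_sec_pred smooth_sec_zmod_closed.

(* Sections of the trivial bundle with fibre [V]. *)
Record smoothSec := SmoothSec {
  smoothSec_val :> M -> V;
  smoothSecP : smoothSec_val \in smooth_sec_pred }.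

HB.instance Definition _ := [isSub for smoothSec_val].
HB.instance Definition _ := [Choice of smoothSec by <:].
HB.instance Definition _ := [SubChoice_isSubZmodule of smoothSec by <:].

Lemma smoothSec_smooth (s : smoothSec) : is_smooth_sec s.
Proof. by have /asboolP := smoothSecP s. Qed.

Lemma smoothFun_smooth (f : smoothFun M) : is_smooth f.
Proof. by have /asboolP := smoothFunP f. Qed.

Lemma is_smooth_secZ (f : smoothFun M) (s : smoothSec) :
  is_smooth_sec (fun x => f x *: s x).
Proof.
move=> i; rewrite (_ : (fun _ => _) =
  f \* (fun x => coord (vbasis {:V}) i (s x))).
  by apply: is_smoothM; [exact: smoothFun_smooth|exact: smoothSec_smooth].
by apply/funext => x /=; rewrite linearZ.
Qed.

Definition secZ (f : smoothFun M) (s : smoothSec) : smoothSec :=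
  SmoothSec (asboolT (is_smooth_secZ f s)).

Lemma smoothSec_eq (s t : smoothSec) : (forall x, s x = t x) -> s = t.
Proof. by move=> e; apply/val_inj/funext. Qed.

Lemma secZA f g s : secZ f (secZ g s) = secZ (f * g) s.
Proof. by apply: smoothSec_eq => x /=; rewrite scalerA. Qed.
Lemma sec1Z : left_id 1 secZ.
Proof. by move=> s; apply: smoothSec_eq => x /=; rewrite scale1r. Qed.
Lemma secZDr : right_distributive secZ +%R.
Proof. by move=> f s t; apply: smoothSec_eq => x /=; rewrite scalerDr. Qed.
Lemma secZDl s : {morph secZ^~ s : f g / f + g}.
Proof. by move=> f g; apply: smoothSec_eq => x /=; rewrite scalerDl. Qed.

HB.instance Definition _ := GRing.Zmodule_isLmodule.Build (smoothFun M)
  smoothSec secZA sec1Z secZDr secZDl.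

Definition sec_coord (s : smoothSec) i : smoothFun M :=
  SmoothFun (asboolT (smoothSec_smooth s i)).

Lemma is_smooth_csec (v : V) : is_smooth_sec (cst v).
Proof. by move=> i; exact: (@is_smooth_cst M (coord (vbasis {:V}) i v)). Qed.

Definition csec (v : V) : smoothSec := SmoothSec (asboolT (is_smooth_csec v)).

End SmoothSections.

Section FibrewiseMaps.
Variable M : manifold.

Lemma is_smooth_lift1 (V W : vectType R) (F : 'Hom(V, W)) (s : smoothSec M V) :
  is_smooth_sec (fun x => F (s x)).
Proof.
move=> i; rewrite (_ : (fun _ => _) = (fun x => \sum_j
   ((fun x => coord (vbasis {:V}) j (s x)) \*
    cst (coord (vbasis {:W}) i (F (vbasis {:V})`_j))) x)).
  apply: is_smooth_sum => j _; apply: is_smoothM; first exact: smoothSec_smooth.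
  exact: is_smooth_cst.
apply/funext => x; rewrite [in LHS](coord_vbasis (memvf (s x))) !linear_sum.
by apply: eq_bigr => j _; rewrite !linearZ.
Qed.

Definition lift1 (V W : vectType R) (F : 'Hom(V, W)) (s : smoothSec M V) :
  smoothSec M W := SmoothSec (asboolT (is_smooth_lift1 F s)).

Lemma is_smooth_lift2 (U V W : vectType R) (B : 'Hom(U, 'Hom(V, W)))
    (s : smoothSec M U) (t : smoothSec M V) :
  is_smooth_sec (fun x => B (s x) (t x)).
Proof.
move=> i; rewrite (_ : (fun _ => _) = (fun x => \sum_j
   ((fun x => coord (vbasis {:U}) j (s x)) \*
    (fun x => coord (vbasis {:W}) i (B (vbasis {:U})`_j (t x)))) x)).
  apply: is_smooth_sum => j _; apply: is_smoothM; first exact: smoothSec_smooth.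
  exact: is_smooth_lift1.
apply/funext => x; rewrite [in LHS](coord_vbasis (memvf (s x))) linear_sum.
rewrite sum_lfunE linear_sum.
by apply: eq_bigr => j _; rewrite linearZ /= scale_lfunE linearZ.
Qed.

Definition lift2 (U V W : vectType R) (B : 'Hom(U, 'Hom(V, W)))
    (s : smoothSec M U) (t : smoothSec M V) : smoothSec M W :=
  SmoothSec (asboolT (is_smooth_lift2 B s t)).

Lemma is_smooth_sec_fun (s : smoothSec M R^o) : is_smooth (s : M -> R).
Proof.
rewrite (_ : (s : M -> R) = (fun x => \sum_j
   ((fun x => coord (vbasis {:R^o}) j (s x)) \*
    cst ((vbasis {:R^o})`_j : R)) x)).
  apply: is_smooth_sum => j _; apply: is_smoothM; first exact: smoothSec_smooth.
  exact: is_smooth_cst.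
by apply/funext => x; rewrite [LHS](coord_vbasis (memvf (s x))).
Qed.

Definition fun_of_sec (s : smoothSec M R^o) : smoothFun M :=
  SmoothFun (asboolT (is_smooth_sec_fun s)).

End FibrewiseMaps.

Section VectorFields.
Variable M : manifold.

(* Vector fields are the derivations of the R-algebra C^oo(M). *)
Record vectorField := VectorField {
  vf_fun :> smoothFun M -> smoothFun M;
  vfD : forall f g, vf_fun (f + g) = vf_fun f + vf_fun g;
  vfZ : forall a f, vf_fun (scst M a * f) = scst M a * vf_fun f;
  vfM : forall f g, vf_fun (f * g) = f * vf_fun g + vf_fun f * g }.

HB.instance Definition _ := gen_eqMixin vectorField.
HB.instance Definition _ := gen_choiceMixin vectorField.

Lemma vf_eq (X Y : vectorField) : (forall f, X f = Y f) -> X = Y.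
Proof.
case: X Y => [x a b c] [y a' b' c'] /= e.
have e' : x = y by apply/funext.
by case: y / e' a' b' c' {e} => *; congr VectorField; exact: Prop_irrelevance.
Qed.

Section Operations.
Variables (h : smoothFun M) (X Y : vectorField).
Implicit Types (a : R) (f g : smoothFun M).

Let zero f : smoothFun M := 0.
Let zeroD f g : zero (f + g) = zero f + zero g.
Proof. by rewrite /zero addr0. Qed.
Let zeroZ a f : zero (scst M a * f) = scst M a * zero f.
Proof. by rewrite /zero mulr0. Qed.
Let zeroM f g : zero (f * g) = f * zero g + zero f * g.
Proof. by rewrite /zero mulr0 mul0r addr0. Qed.
Definition vf0 := VectorField zeroD zeroZ zeroM.

Let opp f := - X f.
Let oppD f g : opp (f + g) = opp f + opp g.
Proof. by rewrite /opp vfD opprD. Qed.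
Let oppZ a f : opp (scst M a * f) = scst M a * opp f.
Proof. by rewrite /opp vfZ mulrN. Qed.
Let oppM f g : opp (f * g) = f * opp g + opp f * g.
Proof. by rewrite /opp vfM opprD mulrN mulNr. Qed.
Definition vf_opp := VectorField oppD oppZ oppM.

Let add f := X f + Y f.
Let addD f g : add (f + g) = add f + add g.
Proof. by rewrite /add !vfD addrACA. Qed.
Let addZ a f : add (scst M a * f) = scst M a * add f.
Proof. by rewrite /add !vfZ mulrDr. Qed.
Let addM f g : add (f * g) = f * add g + add f * g.
Proof. by rewrite /add !vfM addrACA mulrDr mulrDl. Qed.
Definition vf_add := VectorField addD addZ addM.

Let scale f := h * X f.
Let scaleD f g : scale (f + g) = scale f + scale g.
Proof. by rewrite /scale vfD mulrDr. Qed.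
Let scaleZ a f : scale (scst M a * f) = scst M a * scale f.
Proof. by rewrite /scale vfZ mulrCA. Qed.
Let scaleM f g : scale (f * g) = f * scale g + scale f * g.
Proof. by rewrite /scale vfM; ring. Qed.
Definition vf_scale := VectorField scaleD scaleZ scaleM.

Let br f := X (Y f) - Y (X f).
Let brD f g : br (f + g) = br f + br g.
Proof. by rewrite /br !vfD opprD addrACA. Qed.
Let brZ a f : br (scst M a * f) = scst M a * br f.
Proof. by rewrite /br !vfZ mulrBr. Qed.
Let brM f g : br (f * g) = f * br g + br f * g.
Proof.
by rewrite /br !vfM !vfD !vfM; ring. Qed.
Definition lie := VectorField brD brZ brM.

End Operations.

Lemma vf_addA : associative vf_add.
Proof. by move=> X Y Z; apply: vf_eq => f /=; rewrite addrA. Qed.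
Lemma vf_addC : commutative vf_add.
Proof. by move=> X Y; apply: vf_eq => f /=; rewrite addrC. Qed.
Lemma vf_add0 : left_id vf0 vf_add.
Proof. by move=> X; apply: vf_eq => f /=; rewrite add0r. Qed.
Lemma vf_addN : left_inverse vf0 vf_opp vf_add.
Proof. by move=> X; apply: vf_eq => f /=; rewrite addNr. Qed.

HB.instance Definition _ := GRing.isZmodule.Build vectorField
  vf_addA vf_addC vf_add0 vf_addN.

Lemma vf_scaleA f g X : vf_scale f (vf_scale g X) = vf_scale (f * g) X.
Proof. by apply: vf_eq => h /=; rewrite mulrA. Qed.
Lemma vf_scale1 : left_id 1 vf_scale.
Proof. by move=> X; apply: vf_eq => h /=; rewrite mul1r. Qed.
Lemma vf_scaleDr : right_distributive vf_scale +%R.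
Proof. by move=> f X Y; apply: vf_eq => h /=; rewrite mulrDr. Qed.
Lemma vf_scaleDl X : {morph vf_scale^~ X : f g / f + g}.
Proof. by move=> f g; apply: vf_eq => h /=; rewrite mulrDl. Qed.

HB.instance Definition _ := GRing.Zmodule_isLmodule.Build (smoothFun M)
  vectorField vf_scaleA vf_scale1 vf_scaleDr vf_scaleDl.

(* Componentwise derivative; it does not depend on the chosen basis of [V]. *)
Definition Lder (V : vectType R) (X : vectorField) (s : smoothSec M V) :
    smoothSec M V :=
  \sum_i X (sec_coord s i) *: csec M (vbasis {:V})`_i.

End VectorFields.

End Manifolds.

Section LieTheory.
Variable R : realType.

Record lie_group := LieGroup {
  lg_mfd :> manifold R;
  lg_mul : lg_mfd -> lg_mfd -> lg_mfd;
  lg_inv : lg_mfd -> lg_mfd;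
  lg_one : lg_mfd;
  lg_mulA : associative lg_mul;
  lg_mul1 : left_id lg_one lg_mul;
  lg_mulV : left_inverse lg_one lg_inv lg_mul;
  lg_mul_smooth : smooth_map2 lg_mul;
  lg_inv_smooth : smooth_map lg_inv }.

(* A strict Lie 2-group, given by its crossed module of Lie groups. *)
Record strict_lie_2group := StrictLie2Group {
  G1 : lie_group;
  G0 : lie_group;
  Psi : G1 -> G0;
  Phi : G0 -> G1 -> G1;
  Psi_smooth : smooth_map Psi;
  Psi_mul : forall h h', Psi (lg_mul h h') = lg_mul (Psi h) (Psi h');
  Phi_smooth : smooth_map2 Phi;
  Phi_one : forall h, Phi (lg_one G0) h = h;
  Phi_comp : forall g g' h, Phi (lg_mul g g') h = Phi g (Phi g' h);
  Phi_mul : forall g h h', Phi g (lg_mul h h') = lg_mul (Phi g h) (Phi g h');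
  Psi_Phi : forall g h,
    Psi (Phi g h) = lg_mul (lg_mul g (Psi h)) (lg_inv g);
  Phi_Psi : forall h h', Phi (Psi h) h' = lg_mul (lg_mul h h') (lg_inv h) }.

Record lie_algebra := LieAlgebra {
  la_vect :> vectType R;
  la_br : 'Hom(la_vect, 'Hom(la_vect, la_vect));
  la_alt : forall u, la_br u u = 0;
  la_jacobi : forall u v w,
    la_br u (la_br v w) = la_br (la_br u v) w + la_br v (la_br u w) }.

Record lie_crossed_module := LieCrossedModule {
  h1 : lie_algebra;
  h0 : lie_algebra;
  psi : 'Hom(h1, h0);
  phi : 'Hom(h0, 'Hom(h1, h1));
  psi_br : forall m n, psi (la_br h1 m n) = la_br h0 (psi m) (psi n);
  phi_br : forall u v m,
    phi (la_br h0 u v) m = phi u (phi v m) - phi v (phi u m);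
  phi_der : forall u m n,
    phi u (la_br h1 m n) = la_br h1 (phi u m) n + la_br h1 m (phi u n);
  psi_phi : forall u m, psi (phi u m) = la_br h0 u (psi m);
  phi_psi : forall m n, phi (psi m) n = la_br h1 m n }.

Definition left_invariant (H : lie_group) (X : vectorField H) : Prop :=
  forall (f : smoothFun H) g x,
    X (to_smooth (fun y => f (lg_mul g y))) x = X f (lg_mul g x).

(* [iota] identifies [h] with the Lie algebra of left-invariant vector fields
   on [H]. *)
Record is_lie_algebra_of (H : lie_group) (h : lie_algebra)
    (iota : h -> vectorField H) : Prop := IsLieAlgebraOf {
  iota_linear : forall a u v,
    iota (a *: u + v) = scst H a *: iota u + iota v;
  iota_inj : injective iota;
  iota_img : forall X, left_invariant X <-> exists u, iota u = X;
  iota_br : forall u v, iota (la_br h u v) = lie (iota u) (iota v) }.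

(* [psi] is the differential of [Psi] at the identity, and [phi u m] is the
   mixed derivative of [(g, h) |-> Phi g h] at the identities in the directions
   [u] and [m], i.e. the derivative along [u] of [g |-> d(Phi g) m]. *)
Definition is_infinitesimal (G : strict_lie_2group) (g : lie_crossed_module) :
    Prop :=
  exists (iota1 : h1 g -> vectorField (G1 G))
         (iota0 : h0 g -> vectorField (G0 G)),
  [/\ is_lie_algebra_of iota1, is_lie_algebra_of iota0,
      forall m (f : smoothFun (G0 G)),
        iota0 (psi g m) f (lg_one (G0 G)) =
        iota1 m (to_smooth (fun h => f (Psi h))) (lg_one (G1 G)) &
      forall u m (f : smoothFun (G1 G)),
        iota1 (phi g u m) f (lg_one (G1 G)) =
        iota0 u
          (to_smooth (fun k =>
             iota1 m (to_smooth (fun h => f (Phi k h))) (lg_one (G1 G))))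
          (lg_one (G0 G))].

(* The graded symmetric pairing of degree 1 is determined by its component on
   [h0 * h1]; since [h0] has degree 0, [S(m, u) = S(u, m)]. *)
Record is_quadratic_strict (g : lie_crossed_module)
    (S : 'Hom(h0 g, 'Hom(h1 g, R^o))) : Prop := IsQuadraticStrict {
  qs_nondeg0 : forall u, (forall m, S u m = 0) -> u = 0;
  qs_nondeg1 : forall m, (forall u, S u m = 0) -> m = 0;
  qs_l1 : forall m p, S (psi g m) p = S (psi g p) m;
  qs_l2 : forall u v m, S (la_br (h0 g) u v) m = - S v (phi g u m) }.

End LieTheory.

Section Forms.
Variables (R : realType) (M : manifold R).
Implicit Types (E F : lmodType (smoothFun M)).

Definition cochain (k : nat) E := k.-tuple (vectorField M) -> E.

Definition tset k (t : k.-tuple (vectorField M)) (i : 'I_k) X :=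
  [tuple if j == i then X else tnth t j | j < k].

(* E-valued k-forms: alternating C^oo(M)-multilinear maps on vector fields. *)
Definition is_form k E (w : cochain k E) : Prop :=
  (forall t i (f : smoothFun M) X Y,
     w (tset t i (f *: X + Y)) = f *: w (tset t i X) + w (tset t i Y)) /\
  (forall t i j, i != j -> tnth t i = tnth t j -> w t = 0).

Record diff_form k E := DiffForm {
  form_fun :> k.-tuple (vectorField M) -> E;
  formP : is_form form_fun }.

Definition tdel k (i : 'I_k.+1) (t : k.+1.-tuple (vectorField M)) :
    k.-tuple (vectorField M) := [tuple tnth t (lift i j) | j < k].

(* Koszul's formula for the exterior derivative with respect to [D]. In the
   second sum the pair of positions [i < lift i j = j.+1] is parametrised by
   [i <= j]. *)
Definition ext_d E (D : vectorField M -> E -> E) k :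
    cochain k E -> cochain k.+1 E :=
  match k with
  | 0 => fun w t => D (thead t) (w [tuple])
  | k'.+1 => fun w t =>
      (\sum_(i < k'.+2) (-1) ^+ i *: D (tnth t i) (w (tdel i t)))
      + \sum_(i < k'.+2) \sum_(j < k'.+1 | (i <= j)%N)
          (-1) ^+ (i + j.+1)
          *: w [tuple of lie (tnth t i) (tnth t (lift i j))
                         :: tdel j (tdel i t)]
  end.

Definition d_dR k (w : cochain k (smoothFun M)^o) :
    cochain k.+1 (smoothFun M)^o := ext_d (fun X (f : (smoothFun M)^o) => X f : (smoothFun M)^o) w.

Definition d_sec (V : vectType R) k (w : cochain k (smoothSec M V)) :
    cochain k.+1 (smoothSec M V) := ext_d (@Lder R M V) w.

Definition wedge E F (S : E -> F -> (smoothFun M)^o) k l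
    (w : cochain k E) (p : cochain l F) : cochain (k + l) (smoothFun M)^o :=
  fun t => scst M ((k`! * l`!)%:R^-1) *:
    \sum_(s : 'S_(k + l)) (-1) ^+ s *:
      S (w [tuple tnth t (s (lshift l i)) | i < k])
        (p [tuple tnth t (s (rshift k j)) | j < l]).

Definition is_cocycle k (w : cochain k (smoothFun M)^o) : Prop :=
  is_form w /\ forall t, d_dR w t = 0.

Definition is_coboundary k : cochain k (smoothFun M)^o -> Prop :=
  match k with
  | 0 => fun w => forall t, w t = 0
  | k'.+1 => fun w =>
      exists p : diff_form k' (smoothFun M)^o, forall t, w t = d_dR p t
  end.

Definition deRham_class k (w : cochain k (smoothFun M)^o) :
    set (cochain k (smoothFun M)^o) :=
  [set w' | is_coboundary (fun t => w' t - w t)].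

Definition deRhamH k : set (set (cochain k (smoothFun M)^o)) :=
  [set deRham_class w | w in @is_cocycle k].

End Forms.

Section Lie2Algebroids.
Variables (R : realType) (M : manifold R).

(* Operations on the modules of sections [A1] of A_{-1} and [A0] of A_0;
   [l2_00] and [l2_01] are the components of the binary bracket on A_0 * A_0
   and on A_0 * A_{-1}. *)
Record lie2_data := Lie2Data {
  A1 : lmodType (smoothFun M);
  A0 : lmodType (smoothFun M);
  anchor : A0 -> vectorField M;
  l1 : A1 -> A0;
  l2_00 : A0 -> A0 -> A0;
  l2_01 : A0 -> A1 -> A1;
  l3 : A0 -> A0 -> A0 -> A1 }.

Definition l2_10 (L : lie2_data) (m : A1 L) (x : A0 L) : A1 L :=
  - l2_01 x m.

Definition real_linear (E F : lmodType (smoothFun M)) (f : E -> F) : Prop :=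
  forall (a : R) x y, f (scst M a *: x + y) = scst M a *: f x + f y.

Definition fun_linear (E F : lmodType (smoothFun M)) (f : E -> F) : Prop :=
  forall (a : smoothFun M) x y, f (a *: x + y) = a *: f x + f y.

Record is_lie2_algebra (L : lie2_data) : Prop := IsLie2Algebra {
  l1_linear : real_linear (@l1 L);
  l2_linear : forall x, real_linear (@l2_00 L x);
  l2_skew : forall x y : A0 L, l2_00 x y = - l2_00 y x;
  l2_linear_l : forall m, real_linear (fun x : A0 L => l2_01 x m);
  l2_linear_r : forall x, real_linear (@l2_01 L x);
  l3_linear : forall x y, real_linear (@l3 L x y);
  l3_skew12 : forall x y z : A0 L, l3 x y z = - l3 y x z;
  l3_skew23 : forall x y z : A0 L, l3 x y z = - l3 x z y;
  l1_l2 : forall (x : A0 L) m, l1 (l2_01 x m) = l2_00 x (l1 m);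
  l2_l1 : forall m n : A1 L, l2_01 (l1 m) n = l2_10 m (l1 n);
  l1_l3 : forall x y z : A0 L,
    l1 (l3 x y z) =
    l2_00 x (l2_00 y z) - l2_00 (l2_00 x y) z - l2_00 y (l2_00 x z);
  l3_l1 : forall (x y : A0 L) m,
    l3 x y (l1 m) =
    l2_01 x (l2_01 y m) - l2_01 (l2_00 x y) m - l2_01 y (l2_01 x m);
  l3_jacobi : forall w x y z : A0 L,
    l2_01 w (l3 x y z) - l2_01 x (l3 w y z) + l2_01 y (l3 w x z)
    + l2_10 (l3 w x y) z - l3 (l2_00 w x) y z - l3 x (l2_00 w y) z
    - l3 x y (l2_00 w z) + l3 w (l2_00 x y) z + l3 w y (l2_00 x z)
    - l3 w x (l2_00 y z) = 0 }.

Record is_transitive_lie2_algebroid (L : lie2_data) : Prop :=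
    IsTransitiveLie2Algebroid {
  tl2_lie2 : is_lie2_algebra L;
  tl2_anchor_linear : fun_linear (@anchor L);
  tl2_anchor_surj : forall X, exists e : A0 L, anchor e = X;
  tl2_l1_linear : fun_linear (@l1 L);
  tl2_l3_linear : forall x y, fun_linear (@l3 L x y);
  tl2_leibniz0 : forall (x y : A0 L) f,
    l2_00 x (f *: y) = f *: l2_00 x y + anchor x f *: y;
  tl2_leibniz1 : forall (x : A0 L) m f,
    l2_01 x (f *: m) = f *: l2_01 x m + anchor x f *: m }.

(* [S u m] is only meaningful for [u] in the kernel of the anchor. Fibrewise
   nondegeneracy of a pairing of vector bundles is expressed on sections: it
   identifies each module with the C^oo(M)-dual of the other one. *)
Record is_quadratic_lie2_algebroid (L : lie2_data)
    (S : A0 L -> A1 L -> (smoothFun M)^o) : Prop := IsQuadraticLie2Algebroid {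
  ql2_transitive : is_transitive_lie2_algebroid L;
  ql2_linear0 : forall f u v m, anchor u = 0 -> anchor v = 0 ->
    S (f *: u + v) m = f *: S u m + S v m;
  ql2_linear1 : forall u, anchor u = 0 -> fun_linear (S u);
  ql2_nondeg0 : forall u, anchor u = 0 -> (forall m, S u m = 0) -> u = 0;
  ql2_nondeg1 : forall m, (forall u, anchor u = 0 -> S u m = 0) -> m = 0;
  ql2_perfect0 : forall lam : A1 L -> (smoothFun M)^o, fun_linear lam ->
    exists2 u, anchor u = 0 & forall m, lam m = S u m;
  ql2_perfect1 : forall lam : A0 L -> (smoothFun M)^o,
    (forall f u v, anchor u = 0 -> anchor v = 0 ->
       lam (f *: u + v) = f *: lam u + lam v) ->
    exists m, forall u, anchor u = 0 -> lam u = S u m;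
  ql2_l1 : forall m p, S (l1 m) p = S (l1 p) m;
  ql2_l2 : forall e u m, anchor u = 0 ->
    anchor e (S u m) = S (l2_00 e u) m + S u (l2_01 e m);
  ql2_l3 : forall e1 e2 u v, anchor u = 0 -> anchor v = 0 ->
    S v (l3 e1 e2 u) = - S u (l3 e1 e2 v) }.

Section Pontryagin.
Variables (L : lie2_data) (S : A0 L -> A1 L -> (smoothFun M)^o).

Definition is_splitting (sigma : vectorField M -> A0 L) : Prop :=
  fun_linear sigma /\ forall X, anchor (sigma X) = X.

Section Splitting.
Variables (sigma : vectorField M -> A0 L) (gamma : diff_form 2 (A1 L)).

Definition nabla1 (X : vectorField M) (m : A1 L) : A1 L := l2_01 (sigma X) m.

Definition R_curv : cochain 2 (A0 L) := fun t =>
  sigma (lie t`_0 t`_1) - l2_00 (sigma t`_0) (sigma t`_1) - l1 (gamma t).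

Definition I_curv : cochain 3 (A1 L) := fun t =>
  - ext_d nabla1 gamma t - l3 (sigma t`_0) (sigma t`_1) (sigma t`_2).

Definition R_gamma : cochain 2 (A0 L) := fun t => R_curv t + l1 (gamma t).

Definition I_gamma : cochain 3 (A1 L) := fun t =>
  I_curv t + ext_d nabla1 gamma t.

Definition pontryagin_form : cochain 5 (smoothFun M)^o :=
  wedge S R_gamma I_gamma.

End Splitting.

(* [c] is the common class in H^5(M) of all the Pontryagin forms. *)
Definition is_first_pontryagin_class (c : set (cochain 5 (smoothFun M)^o)) :
    Prop :=
  [/\ deRhamH c,
      exists sigma, is_splitting sigma &
      forall sigma gamma, is_splitting sigma ->
        is_cocycle (pontryagin_form sigma gamma) /\
        deRham_class (pontryagin_form sigma gamma) = c].

End Pontryagin.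
End Lie2Algebroids.

Section Connection.
Variables (R : realType) (g : lie_crossed_module R) (M : manifold R).
Variables (A : diff_form 1 (smoothSec M (h0 g))).
Variables (B : diff_form 2 (smoothSec M (h1 g))).

Local Notation sec0 := (smoothSec M (h0 g)).
Local Notation sec1 := (smoothSec M (h1 g)).

Definition fl1 (m : sec1) : sec0 := lift1 (psi g) m.
Definition fl2_00 (u v : sec0) : sec0 := lift2 (la_br (h0 g)) u v.
Definition fl2_01 (u : sec0) (m : sec1) : sec1 := lift2 (phi g) u m.
Definition fl2_10 (m : sec1) (u : sec0) : sec1 := - fl2_01 u m.

Definition l2_AA : cochain 2 sec0 := fun t =>
  fl2_00 (A [tuple t`_0]) (A [tuple t`_1]) *+ 2.

Definition l2_AB : cochain 3 sec1 := fun t =>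
  fl2_01 (A [tuple t`_0]) (B [tuple t`_1; t`_2])
  + fl2_01 (A [tuple t`_1]) (B [tuple t`_2; t`_0])
  + fl2_01 (A [tuple t`_2]) (B [tuple t`_0; t`_1]).

Definition fcurv : cochain 2 sec0 := fun t =>
  d_sec A t + scst M (2^-1) *: l2_AA t - fl1 (B t).

Definition curv : cochain 3 sec1 := fun t => d_sec B t + l2_AB t.

Definition connection_lie2 : lie2_data M :=
  @Lie2Data R M sec1 (vectorField M * sec0)%type
    (fun x => x.1)
    (fun m => (0, fl1 m))
    (fun x y =>
       let: (X, u) := x in let: (Y, v) := y in
       (lie X Y,
        Lder X v + fl2_00 (A [tuple X]) v - Lder Y u - fl2_00 (A [tuple Y]) u
        + fcurv [tuple X; Y] + fl2_00 u v))
    (fun x m =>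
       let: (X, u) := x in
       Lder X m + fl2_01 (A [tuple X]) m + fl2_01 u m)
    (fun x y z =>
       let: (X, u) := x in let: (Y, v) := y in let: (Z, w) := z in
       - curv [tuple X; Y; Z] + fl2_10 (B [tuple X; Y]) w
       + fl2_10 (B [tuple Y; Z]) u + fl2_10 (B [tuple Z; X]) v).

Variable S : 'Hom(h0 g, 'Hom(h1 g, R^o)).

Definition sec_pairing (u : sec0) (m : sec1) : (smoothFun M)^o :=
  fun_of_sec (lift2 S u m).

Definition connection_pairing (x : A0 connection_lie2)
    (m : A1 connection_lie2) : (smoothFun M)^o := sec_pairing x.2 m.

Definition connection_5form : cochain 5 (smoothFun M)^o := fun t =>
  - wedge sec_pairing fcurv curv t.

End Connection.

Arguments connection_pairing {R g M} A B S x m.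
Arguments connection_5form {R g M} A B S t.

(* Main.v *)
Require Import Defs.
From HB Require Import structures.
From mathcomp Require Import all_boot all_order all_fingroup all_algebra.
From mathcomp Require Import ring.
From mathcomp Require Import all_classical all_reals all_analysis.

Set Implicit Arguments.
Unset Strict Implicit.
Unset Printing Implicit Defensive.

Import Order.TTheory GRing.Theory Num.Theory numFieldNormedType.Exports.
Local Open Scope classical_set_scope.
Local Open Scope ring_scope.

(** The curvatures of a connection [(A, B)] are those of two covariant
derivatives.  Writing [D0 = d + [A, -]] on [h]-valued forms and
[D1 = d + phi_A] on [h^*]-valued ones, one has [curv (A, B) = D1 B] and
[fcurv (A, B) = F - psi B], where [F = d A + 1/2 [A, A]] is the curvature of
[A].  Three facts make [- S (fcurv, curv)] exact: the Bianchi identity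
[D0 F = 0]; the invariance of [S], which gives the Leibniz rule
[d S (u, m) = S (D0 u, m) + S (u, D1 m)] for 2-forms ([d_wedge22]); and the
symmetry of [S (psi m, n)] in [m] and [n].  Together they yield
[d S (F, B) = S (F, D1 B)] and [d S (psi B, B) = 2 S (psi B, D1 B)], hence
[- S (fcurv, curv) = d (1/2 S (psi B, B) - S (F, B))], which is
[d_primitive].  The 5-form is therefore also closed, by [d d = 0].

The Pontryagin class reduces to this.  A splitting of the anchor has the
form [X |-> (X, a X)] for an [h]-valued 1-form [a], and a direct computation
identifies its Pontryagin form, for every [gamma], with the 5-form of the
connection [(A + a, B)] ([pontryagin_formE]).  Since the 5-form of every
connection is exact, all the Pontryagin forms are cocycles with class zero.

The Lie 2-algebra axioms are obtained in two steps.  Forgetting [B], the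
operations form a strict Lie 2-algebra; its Jacobi identities say that [F] is
the curvature of [D0] and [D1] and satisfies the Bianchi identity.  The
2-form [B] then twists it: a skew map [b : A_0 x A_0 -> A_{-1}] which
vanishes on the image of [l_1] changes [l_2] by [- l_1 b] and produces
[l_3 = - d b] ([twist_is_lie2_algebra]).  Fibrewise nondegeneracy of [S]
becomes perfectness on sections through dual bases ([section_perfect]).

Vector fields are derivations of the algebra of smooth functions and forms
are alternating multilinear maps on them, so the calculus of forms is that of
a Lie-Rinehart algebra and uses no charts.  It rests on the formula
[i_X d = L_X - d i_X] ([cartan]): since a form is determined by its
contractions, that [d w] is a form and that [d d = 0] follow by induction on
the degree. *)

(** * A decision procedure for identities in abelian groups *)

(** Identities between signed sums of elements of a module, often with more
than a hundred terms, occur throughout.  An expression is flattened into the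
list of its atoms with sign [+] and the list of those with sign [-], so that
an identity amounts to a permutation of lists. *)
Inductive zexpr := ZVar of nat | ZZero | ZAdd of zexpr & zexpr | ZOpp of zexpr.

Fixpoint zeval (V : zmodType) (env : seq V) e : V :=
  match e with
  | ZVar n => nth 0 env n
  | ZZero => 0
  | ZAdd e1 e2 => zeval env e1 + zeval env e2
  | ZOpp e => - zeval env e
  end.

Fixpoint zflat e : seq nat * seq nat :=
  match e with
  | ZVar n => ([:: n], [::])
  | ZZero => ([::], [::])
  | ZAdd e1 e2 =>
      let: (p1, n1) := zflat e1 in let: (p2, n2) := zflat e2 in
      (p1 ++ p2, n1 ++ n2)
  | ZOpp e => let: (p, n) := zflat e in (n, p)
  end.

Lemma zflatP (V : zmodType) (env : seq V) e :
  zeval env e = \sum_(i <- (zflat e).1) nth 0 env i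
                - \sum_(i <- (zflat e).2) nth 0 env i.
Proof.
elim: e => [n||e1 IH1 e2 IH2|e IHe] /=.
- by rewrite big_seq1 big_nil subr0.
- by rewrite !big_nil subr0.
- rewrite IH1 IH2; case: (zflat e1) (zflat e2) => [p1 n1] [p2 n2] /=.
  by rewrite !big_cat opprD addrACA.
- by rewrite IHe; case: (zflat e) => [p n] /=; rewrite opprB.
Qed.

Lemma zeval_eq (V : zmodType) (env : seq V) e1 e2 :
  perm_eq ((zflat e1).1 ++ (zflat e2).2) ((zflat e2).1 ++ (zflat e1).2) ->
  zeval env e1 = zeval env e2.
Proof.
move=> e12; have := perm_big _ e12 : \sum_(i <- _) nth 0 env i = _.
rewrite !big_cat /= !zflatP => e; apply/eqP.
by rewrite subr_eq addrAC eq_sym subr_eq e.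
Qed.

(* Atoms are compared syntactically first and up to unification second: equal
   terms may carry different presentations of the same algebraic structure. *)
Ltac zfind_syntactic a env :=
  lazymatch env with
  | a :: _ => constr:(0%N)
  | _ :: ?env' => let n := zfind_syntactic a env' in constr:(n.+1)
  end.
Ltac zfind_unify a env :=
  match env with
  | ?b :: _ => let _ := match goal with _ => unify a b end in constr:(0%N)
  | _ :: ?env' => let n := zfind_unify a env' in constr:(n.+1)
  end.
Ltac zfind a env :=
  match env with
  | _ => zfind_syntactic a env
  | _ => zfind_unify a env
  end.
Ltac zinsert a env :=
  match env with
  | _ => let n := zfind a env in env
  | _ => constr:(a :: env)
  end.
Ltac zatoms t env :=
  lazymatch t with
  | @GRing.zero _ => env
  | @GRing.add _ ?a ?b => let env' := zatoms a env in zatoms b env'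
  | @GRing.opp _ ?a => zatoms a env
  | _ => zinsert t env
  end.
Ltac zreify t env :=
  lazymatch t with
  | @GRing.zero _ => constr:(ZZero)
  | @GRing.add _ ?a ?b =>
      let ea := zreify a env in let eb := zreify b env in constr:(ZAdd ea eb)
  | @GRing.opp _ ?a => let ea := zreify a env in constr:(ZOpp ea)
  | _ => let n := zfind t env in constr:(ZVar n)
  end.
Ltac zmod :=
  lazymatch goal with
  | |- @eq ?T ?l ?r =>
    let env := zatoms l (@nil T) in
    let env := zatoms r env in
    let el := zreify l env in let er := zreify r env in
    apply: (@zeval_eq _ env el er); vm_compute; exact: isT
  end.

(** * Vector fields and tuples of vector fields *)

Section VectorFieldBracket.
Variables (R : realType) (M : manifold R).
Implicit Types (X Y Z : vectorField M) (f : smoothFun M).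

Lemma vfE_add X Y f : (X + Y) f = X f + Y f. Proof. by []. Qed.
Lemma vfE_opp X f : (- X) f = - X f. Proof. by []. Qed.
Lemma vfE_scale h X f : (h *: X) f = h * X f. Proof. by []. Qed.
Definition vfE := (vfE_add, vfE_opp, vfE_scale).

Lemma vf_map0 X : X 0 = 0.
Proof.
by have /eqP := vfD X 0 0; rewrite addr0 -subr_eq subrr eq_sym => /eqP.
Qed.

Lemma vf_mapN X f : X (- f) = - X f.
Proof. by apply/eqP; rewrite -addr_eq0 -vfD addNr vf_map0. Qed.

Lemma vf_map1 X : X 1 = 0.
Proof.
have /eqP := vfM X 1 1; rewrite !mulr1 mul1r -subr_eq subrr eq_sym.
by move/eqP.
Qed.

Lemma vf_cst X a : X (scst M a) = 0.
Proof. by rewrite -[scst M a]mulr1 vfZ vf_map1 mulr0. Qed.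

Lemma lieE X Y f : lie X Y f = X (Y f) - Y (X f). Proof. by []. Qed.

Lemma lieXX X : lie X X = 0.
Proof. by apply: vf_eq => f; rewrite lieE subrr. Qed.

Lemma lieC X Y : lie X Y = - lie Y X.
Proof. by apply: vf_eq => f; rewrite vfE !lieE opprB. Qed.

Lemma lieDZr X f Y Z : lie X (f *: Y + Z) = f *: lie X Y + X f *: Y + lie X Z.
Proof. by apply: vf_eq => h; rewrite !vfE !lieE !vfE vfD vfM; ring. Qed.

Lemma lieDZl f X Y Z : lie (f *: X + Y) Z = f *: lie X Z - Z f *: X + lie Y Z.
Proof. by rewrite lieC lieDZr (lieC X) (lieC Y) !opprD -scalerN. Qed.

Lemma lieDr X Y Z : lie X (Y + Z) = lie X Y + lie X Z.
Proof. by apply: vf_eq => h; rewrite !vfE !lieE !vfE vfD; zmod. Qed.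

Lemma lie0r X : lie X 0 = 0.
Proof. by apply: (addrI (lie X 0)); rewrite -lieDr !addr0. Qed.

Lemma lie_jacobi X Y Z : lie X (lie Y Z) = lie (lie X Y) Z + lie Y (lie X Z).
Proof.
by apply: vf_eq => h; rewrite !vfE !lieE !vfD !vf_mapN; zmod.
Qed.

End VectorFieldBracket.

Reserved Notation "X ::: t" (at level 60, right associativity).

Section Tuples.
Variables (R : realType) (M : manifold R).
Implicit Types (X Y : vectorField M).

(** Adding a vector field in front, with its type fixed to [vectorField M]
rather than to the carrier of a module, so that rewriting is not blocked. *)
Definition vcons k X (t : k.-tuple (vectorField M)) :
  k.+1.-tuple (vectorField M) := [tuple of X :: t].
Local Notation "X ::: t" := (vcons X t).

Lemma vcons0 k X (t : k.-tuple _) : tnth (X ::: t) ord0 = X.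
Proof. by []. Qed.

Lemma vconsS k X (t : k.-tuple _) i : tnth (X ::: t) (lift ord0 i) = tnth t i.
Proof. exact: tnthS. Qed.

Lemma vconsP k (t : k.+1.-tuple (vectorField M)) : exists X t', t = X ::: t'.
Proof. by case/tupleP: t => X t; exists X, t. Qed.

Lemma tset0 k X Y (t : k.-tuple _) :
  tset (Y ::: t) ord0 X = (X ::: t).
Proof.
apply: eq_from_tnth => i; rewrite tnth_mktuple.
by case: (unliftP ord0 i) => [j ->|->]; rewrite //= !vconsS.
Qed.

Lemma tsetS k X Y (t : k.-tuple _) i :
  tset (Y ::: t) (lift ord0 i) X = (Y ::: tset t i X).
Proof.
apply: eq_from_tnth => j; rewrite tnth_mktuple.
case: (unliftP ord0 j) => [j' ->|->]; rewrite ?vconsS //.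
by rewrite tnth_mktuple (inj_eq lift_inj).
Qed.

Lemma tset_id k (t : k.-tuple (vectorField M)) i : tset t i (tnth t i) = t.
Proof.
apply: eq_from_tnth => j; rewrite tnth_mktuple.
by case: eqP => // ->.
Qed.

Lemma tdel0 k Y (t : k.-tuple (vectorField M)) : tdel ord0 (Y ::: t) = t.
Proof. by apply: eq_from_tnth => j; rewrite tnth_mktuple vconsS. Qed.

Lemma lift0_lift k (i : 'I_k.+2) (j : 'I_k.+1) :
  lift (lift ord0 i) (lift ord0 j) = lift ord0 (lift i j).
Proof. by apply: val_inj; rewrite /= /bump !leq0n !add1n ltnS addnS. Qed.

Lemma tdelS k Y (t : k.+1.-tuple (vectorField M)) i :
  tdel (lift ord0 i) (Y ::: t) = (Y ::: tdel i t).
Proof.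
apply: eq_from_tnth => j; rewrite tnth_mktuple.
case: (unliftP ord0 j) => [j' ->|->]; last first.
  by rewrite (_ : lift _ _ = ord0) //; apply: val_inj.
case: k t i j j' => [|k] t i j j'; first by case: j'.
by rewrite lift0_lift !vconsS tnth_mktuple.
Qed.

End Tuples.
Notation "X ::: t" := (vcons X t).

(** * Alternating forms *)

Section Alternating.
Variables (R : realType) (M : manifold R) (E : lmodType (smoothFun M)).
Implicit Types (X Y Z : vectorField M) (f : smoothFun M).

Definition contr k X (w : cochain k.+1 E) : cochain k E :=
  fun t => w (X ::: t).

(** A form of positive degree is recognized from its contractions, which makes
induction on the degree possible.  In the third condition, [i] of value [0]
in ['I_k] states at once that [k] is positive and that the second entry is
again [X]. *)
Lemma is_formS k (w : cochain k.+1 E) :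
  [/\ forall X, is_form (contr X w),
      forall f X Y t, w (f *: X + Y ::: t)
                      = f *: w (X ::: t) + w (Y ::: t) &
      forall X t (i : 'I_k), val i = 0%N -> tnth t i = X ->
        w (X ::: t) = 0] <-> is_form w.
Proof.
split; last first.
  case=> wl wa; split=> [X|f X Y t|X t i _ tX].
  - split=> [t i f Y Z|t i j nij tij]; rewrite /contr.
      by rewrite -!tsetS wl.
    apply: (wa _ (lift ord0 i) (lift ord0 j)).
      by rewrite (inj_eq lift_inj).
    by rewrite !vconsS.
  - by have := wl (0 ::: t) ord0 f X Y; rewrite !tset0.
  - by apply: (wa _ ord0 (lift ord0 i)); rewrite ?vconsS.
case=> wf wl wa; split.
  move=> t i f X Y; have [Z [{}t ->]] := vconsP t.
  case: (unliftP ord0 i) => [j ->|->]; rewrite ?tset0 ?wl //.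
  by rewrite !tsetS; have [h _] := wf Z; exact: h.
have wlD X Y t : w (X + Y ::: t)
     = w (X ::: t) + w (Y ::: t).
  by have := wl 1 X Y t; rewrite !scale1r.
have wa0 X t j : tnth t j = X -> w (X ::: t) = 0.
  case: k w wf wl wa wlD t j => [|k] w wf wl wa wlD t j; first by case: j.
  have [Y [{}t ->]] := vconsP t.
  case: (unliftP ord0 j) => [i ->|->] tX; last first.
    exact: (wa _ _ ord0).
  rewrite vconsS in tX.
  (* Polarization in the first two slots moves [X] away from the front. *)
  have := wa (X + Y) (X + Y ::: t) ord0 erefl erefl.
  have wlD' Z : w (Z ::: (X + Y ::: t)) =
    w (Z ::: (X ::: t)) + w (Z ::: (Y ::: t)).
    have [h _] := wf Z; have := h (0 ::: t) ord0 1 X Y.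
    by rewrite !tset0 !scale1r.
  rewrite wlD !wlD' (wa X (X ::: t) ord0) //.
  rewrite (wa Y (Y ::: t) ord0) // add0r addr0.
  have [_ h] := wf Y; have -> : w (Y ::: (X ::: t)) = 0.
    by apply: (h _ ord0 (lift ord0 i)); rewrite ?vconsS.
  by rewrite addr0.
move=> t i j; have [Z [{}t ->]] := vconsP t.
case: (unliftP ord0 i) => [i' ->|->]; case: (unliftP ord0 j) => [j' ->|->] //.
- rewrite (inj_eq lift_inj) !vconsS => nij tij.
  by have [_ h] := wf Z; apply: h tij.
- by rewrite vconsS => _ tZ; apply: wa0 tZ.
- by rewrite vconsS => _ tZ; apply: wa0 (esym tZ).
Qed.

Lemma form_contr k (w : cochain k.+1 E) X : is_form w -> is_form (contr X w).
Proof. by case/is_formS. Qed.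

Lemma form_scaleD k f (w p : cochain k E) :
  is_form w -> is_form p -> is_form (fun t => f *: w t + p t).
Proof.
case=> wl wa [pl pa]; split=> [t i h X Y|t i j nij tij].
  by rewrite wl pl !scalerDr !scalerA (mulrC f); zmod.
by rewrite (wa _ _ _ nij tij) (pa _ _ _ nij tij) scaler0 addr0.
Qed.

Lemma form_zero k : is_form (fun _ : k.-tuple (vectorField M) => 0 : E).
Proof. by split=> *; rewrite ?scaler0 ?addr0. Qed.

Lemma form_sub k (w p : cochain k E) :
  is_form w -> is_form p -> is_form (fun t => w t - p t).
Proof.
move=> fw fp; have := form_scaleD (-1) fp fw.
congr is_form; apply/funext => t.
by rewrite scaleN1r addrC.
Qed.

Lemma form_deg0 (w : cochain 0 E) : is_form w.
Proof. by split=> [t []|t []]. Qed.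

Section Fixed.
Variables (k : nat) (w : cochain k.+1 E).
Hypothesis fw : is_form w.

Lemma form_consDZ f X Y t : w (f *: X + Y ::: t)
  = f *: w (X ::: t) + w (Y ::: t).
Proof. by case/is_formS: fw. Qed.

Lemma form_consD X Y t : w (X + Y ::: t)
  = w (X ::: t) + w (Y ::: t).
Proof. by have := form_consDZ 1 X Y t; rewrite !scale1r. Qed.

Lemma form_cons0 t : w (0 ::: t) = 0.
Proof. by apply: (addrI (w (0 ::: t))); rewrite -form_consD !addr0. Qed.

Lemma form_consZ f X t : w (f *: X ::: t) = f *: w (X ::: t).
Proof. by rewrite -[f *: X]addr0 form_consDZ form_cons0 addr0. Qed.

End Fixed.

Lemma form_alt k (w : cochain k.+2 E) X t : is_form w -> w (X ::: X ::: t) = 0.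
Proof.
by case=> _ wa; apply: (wa _ ord0 (lift ord0 ord0)); rewrite ?vconsS.
Qed.

Lemma form_swap k (w : cochain k.+2 E) X Y t : is_form w ->
  w (X ::: (Y ::: t)) = - w (Y ::: (X ::: t)).
Proof.
move=> fw; have := form_alt (X + Y) t fw; rewrite form_consD //.
rewrite -2![w (_ ::: _ + _ ::: _)]/(contr _ w (_ + _ ::: _)).
rewrite !form_consD; do ?exact: form_contr.
by rewrite /contr !form_alt // add0r addr0 => /eqP; rewrite addr_eq0 => /eqP.
Qed.

(** Moving an entry from position [i] to the front takes [i] transpositions.
*)
Lemma form_move k (w : cochain k.+1 E) X t i : is_form w ->
  w (X ::: tdel i t) = (-1) ^+ i *: w (tset t i X).
Proof.
elim: k w t i => [|k IHk] w t i fw; have [Z [{}t ->]] := vconsP t.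
  by rewrite (ord1 i) scale1r tset0 tdel0.
case: (unliftP ord0 i) => [j ->|->]; last by rewrite scale1r tset0 tdel0.
rewrite tdelS tsetS form_swap // lift0 exprS mulN1r scaleNr; congr (- _).
exact: (IHk (contr Z w) t j (form_contr Z fw)).
Qed.

End Alternating.

(** * Cartan calculus of a covariant derivative *)

Section Cartan.
Variables (R : realType) (M : manifold R) (E : lmodType (smoothFun M)).
Variable D : vectorField M -> E -> E.
Implicit Types (X Y Z : vectorField M) (f : smoothFun M).

Record is_connection : Prop := IsConnection {
  conn_vf : forall f X Y e, D (f *: X + Y) e = f *: D X e + D Y e;
  connD : forall X e e', D X (e + e') = D X e + D X e';
  connM : forall X f e, D X (f *: e) = f *: D X e + X f *: e }.

Definition is_flat : Prop :=
  forall X Y e, D (lie X Y) e = D X (D Y e) - D Y (D X e).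

Hypothesis DP : is_connection.

Lemma conn0 X : D X 0 = 0.
Proof.
have /eqP := connD DP X 0 0.
by rewrite addr0 -subr_eq subrr eq_sym => /eqP.
Qed.

Lemma conn0l e : D 0 e = 0.
Proof.
have /eqP := conn_vf DP 1 0 0 e.
by rewrite !scale1r addr0 -subr_eq subrr eq_sym => /eqP.
Qed.

Lemma connN X e : D X (- e) = - D X e.
Proof. by apply/eqP; rewrite -addr_eq0 -connD // addNr conn0. Qed.

Lemma connB X e e' : D X (e - e') = D X e - D X e'.
Proof. by rewrite connD // connN. Qed.

Lemma conn_sum X I (r : seq I) (P : pred I) (F : I -> E) :
  D X (\sum_(i <- r | P i) F i) = \sum_(i <- r | P i) D X (F i).
Proof. exact: (big_morph (D X) (connD DP X) (conn0 X)). Qed.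

(** The Lie derivative of forms along [X] that [D] induces on the values. *)
Definition lieD k X (w : cochain k E) : cochain k E := fun t =>
  D X (w t) - \sum_(i < k) w (tset t i (lie X (tnth t i))).

Lemma lieD_deg0 X (w : cochain 0 E) t : lieD X w t = D X (w t).
Proof. by rewrite /lieD big_ord0 subr0. Qed.

(** The commutator of [L_X] with contractions carries statements on [L_X] from
one degree to the next. *)
Lemma contr_lieD k X Y (w : cochain k.+1 E) t :
  lieD X w (Y ::: t) = lieD X (contr Y w) t - w (lie X Y ::: t).
Proof.
rewrite /lieD big_ord_recl tset0 vcons0 opprD.
by under eq_bigr do rewrite vconsS tsetS; rewrite /contr; zmod.
Qed.

Lemma lieD_scaleD k X f (w p : cochain k E) t :
  lieD X (fun t => f *: w t + p t) t
  = f *: lieD X w t + X f *: w t + lieD X p t.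
Proof.
rewrite /lieD connD // connM // big_split /= -scaler_sumr.
by rewrite scalerBr opprD; zmod.
Qed.

Lemma lieDB k X (w p : cochain k E) t :
  lieD X (fun t => w t - p t) t = lieD X w t - lieD X p t.
Proof. by rewrite /lieD connB sumrB; zmod. Qed.

Lemma form_lieD k X (w : cochain k E) : is_form w -> is_form (lieD X w).
Proof.
elim: k w => [|k IHk] w fw; first exact: form_deg0.
have cE Y : contr Y (lieD X w) =
    (fun t => lieD X (contr Y w) t - contr (lie X Y) w t).
  by apply/funext => t; rewrite /contr contr_lieD.
apply/is_formS; split=> [Y|f Y Z t|Y t i].
- rewrite cE.
  apply: (@form_sub _ _ _ _ (lieD X (contr Y w)) (contr (lie X Y) w)).
    by apply: IHk; exact: form_contr.
  exact: form_contr.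
- rewrite !contr_lieD (_ : contr _ w = fun t => f *: contr Y w t + contr Z w t).
    rewrite lieD_scaleD lieDZr !(form_consD fw) !(form_consZ fw) /contr.
    by rewrite [in RHS]scalerBr; zmod.
  by apply/funext => s; rewrite /contr form_consDZ.
- case: k IHk w fw cE t i => [|k] IHk w fw cE t i; first by case: i.
  have [Z [{}t ->]] := vconsP t.
  move=> i0; rewrite (_ : i = ord0) ?vcons0 => [->|]; last exact: val_inj.
  rewrite !contr_lieD /contr (form_swap (lie X Y) Y) // opprK.
  rewrite addrAC -addrA subrr addr0.
  rewrite /lieD big1 => [|j _]; rewrite form_alt //.
  by rewrite conn0 subr0.
Qed.

(** The middle sum is [d f] wedge [w]. *)
Lemma ext_d_scaleD k f (w p : cochain k.+1 E) t :
  ext_d D (fun t => f *: w t + p t) t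
  = f *: ext_d D w t
    + \sum_(i < k.+2) (-1) ^+ i *: (tnth t i f *: w (tdel i t))
    + ext_d D p t.
Proof.
rewrite /= scalerDr !scaler_sumr.
under eq_bigr do rewrite connD // connM // !scalerDr.
rewrite !big_split /=.
under [X in _ + X = _]eq_bigr => i _.
  under eq_bigr do rewrite scalerDr.
  rewrite big_split; over.
rewrite big_split /=.
under [X in _ = X + _ + _ + _]eq_bigr do rewrite scalerA mulrC -scalerA.
under [X in _ = _ + X + _ + _]eq_bigr do rewrite scaler_sumr.
under [X in _ = _ + X + _ + _]eq_bigr => i _ do
  under eq_bigr do rewrite scalerA mulrC -scalerA.
by zmod.
Qed.

Lemma ext_d0 k t : ext_d D (fun _ : k.-tuple (vectorField M) => 0) t = 0.
Proof.
case: k t => [|k] t; first by rewrite /= conn0.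
rewrite /= big1 ?add0r => [|i _]; last by rewrite conn0 scaler0.
by rewrite big1 // => i _; rewrite big1 // => j _; rewrite scaler0.
Qed.

Lemma ext_dB k (w p : cochain k E) t :
  ext_d D (fun t => w t - p t) t = ext_d D w t - ext_d D p t.
Proof.
case: k w p t => [|k] w p t; first by rewrite /= connB.
rewrite (_ : (fun _ => _) = fun t => (-1) *: p t + w t); last first.
  by apply/funext => s; rewrite scaleN1r addrC.
rewrite ext_d_scaleD big1 ?addr0 => [|i _]; last first.
  by rewrite vf_mapN vf_map1 oppr0 scale0r scaler0.
by rewrite scaleN1r addrC.
Qed.

Lemma ext_dE k (w : cochain k.+1 E) t :
  ext_d D w t = \sum_(i < k.+2) (-1) ^+ i *: D (tnth t i) (w (tdel i t))
    + \sum_(i < k.+2) \sum_(j < k.+1 | (i <= j)%N) (-1) ^+ (i + j.+1)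
        *: w (lie (tnth t i) (tnth t (lift i j)) ::: tdel j (tdel i t)).
Proof. by []. Qed.

Lemma ext_d_deg0 (w : cochain 0 E) X t : ext_d D w (X ::: t) = D X (w t).
Proof. by rewrite (tuple0 t). Qed.

(** In the Koszul formula for [X ::: t], the terms in which [X] is the
differentiating field or enters the bracket make up [L_X w]; in the others [X]
stays in front and they give [- d (i_X w)], because the bracket [lie t_i t_j]
must be swapped with [X]. *)
Lemma cartan k (w : cochain k.+1 E) X t : is_form w ->
  ext_d D w (X ::: t) = lieD X w t - ext_d D (contr X w) t.
Proof.
move=> fw; rewrite ext_dE big_ord_recl vcons0 tdel0 scale1r.
under eq_bigr do rewrite vconsS tdelS lift0 exprS mulN1r scaleNr.
rewrite sumrN [X in _ + X]big_ord_recl.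
under [X in _ + (X + _) = _]eq_bigr => j _.
  rewrite vcons0 vconsS tdel0 form_move // scalerA add0n exprS mulN1r mulNr.
  by rewrite -exprD addnn -signr_odd odd_double scaleN1r over.
rewrite sumrN /lieD.
case: k w fw t => [|k] w fw t.
  rewrite [X in _ + (_ + X)]big_ord_recl big_ord0 addr0.
  rewrite [X in _ + (_ + X)]big1 ?addr0 => [|j]; last by rewrite (ord1 j).
  rewrite [X in _ - X + _]big_ord_recl big_ord0 addr0 scale1r.
  have [Y [{}t ->]] := vconsP t.
  by rewrite ext_d_deg0 vcons0 tdel0 (tuple0 t) /contr; zmod.
have inner (i : 'I_k.+2) :
    \sum_(j < k.+2 | (lift ord0 i <= j)%N) (-1) ^+ (lift ord0 i + j.+1) *:
      w (lie (tnth (X ::: t) (lift ord0 i))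
             (tnth (X ::: t) (lift (lift ord0 i) j))
         ::: tdel j (tdel (lift ord0 i) (X ::: t)))
    = - \sum_(j < k.+1 | (i <= j)%N) (-1) ^+ (i + j.+1) *:
      contr X w (lie (tnth t i) (tnth t (lift i j)) ::: tdel j (tdel i t)).
  (* The index [j = 0] is excluded by [lift ord0 i <= j]. *)
  rewrite big_mkcond big_ord_recl lift0 ltn0 Monoid.mul1m -sumrN.
  rewrite [RHS]big_mkcond; apply: eq_bigr => j _; rewrite !lift0 ltnS.
  case: ifP => // _; rewrite lift0_lift !vconsS !tdelS form_swap //.
  rewrite scalerN; congr (- (_ *: _)).
  by rewrite addSn [(i + j.+2)%N]addnS 2!exprS !mulN1r opprK.
rewrite (eq_bigr _ (fun i _ => inner i)) sumrN ext_dE /contr.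
by zmod.
Qed.

Lemma contr_ext_d k (w : cochain k.+1 E) X : is_form w ->
  contr X (ext_d D w) = fun t => lieD X w t - ext_d D (contr X w) t.
Proof. by move=> fw; apply/funext => t; rewrite /contr cartan. Qed.

Lemma contr_ext_d0 (w : cochain 0 E) X : contr X (ext_d D w) = lieD X w.
Proof.
by apply/funext => t; rewrite /contr ext_d_deg0 lieD_deg0.
Qed.

Lemma contr_scaleD k (w : cochain k.+1 E) f X Y : is_form w ->
  contr (f *: X + Y) w = fun t => f *: contr X w t + contr Y w t.
Proof. by move=> fw; apply/funext => t; rewrite /contr form_consDZ. Qed.

Lemma contr_contr k (w : cochain k.+2 E) X : is_form w ->
  contr X (contr X w) = fun=> 0.
Proof. by move=> fw; apply/funext => t; rewrite /contr form_alt. Qed.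

(** Tensoriality in [X] fails by the same sum as in [ext_d_scaleD]; the two
defects cancel in Cartan's formula, which is why [ext_d] preserves forms. *)
Lemma lieD_scaleDl k f X Y (w : cochain k.+1 E) t : is_form w ->
  lieD (f *: X + Y) w t = f *: lieD X w t
    + \sum_(i < k.+1) (-1) ^+ i *: (tnth t i f *: contr X w (tdel i t))
    + lieD Y w t.
Proof.
move=> fw; rewrite /lieD conn_vf // scalerBr.
have h (i : 'I_k.+1) : w (tset t i (lie (f *: X + Y) (tnth t i)))
    = f *: w (tset t i (lie X (tnth t i)))
      - (-1) ^+ i *: (tnth t i f *: contr X w (tdel i t))
      + w (tset t i (lie Y (tnth t i))).
  have [wl _] := fw; rewrite lieDZl -[in LHS]addrA wl -[RHS]addrA.
  congr (_ + _).
  rewrite -scaleNr wl scaleNr; congr (- _ + _).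
  by rewrite /contr form_move // !scalerA mulrAC -expr2 sqrr_sign mul1r.
rewrite (eq_bigr _ (fun i _ => h i)) !big_split /= sumrN scaler_sumr.
by zmod.
Qed.

Lemma form_ext_d k (w : cochain k E) : is_form w -> is_form (ext_d D w).
Proof.
elim: k w => [|k IHk] w fw.
  apply/is_formS; split=> [X|f X Y t|X t []//]; first exact: form_deg0.
  by rewrite !ext_d_deg0 conn_vf.
apply/is_formS; split=> [X|f X Y t|X t i].
- rewrite contr_ext_d //; apply: form_sub; first exact: form_lieD.
  by apply: IHk; exact: form_contr.
- rewrite !cartan // lieD_scaleDl // contr_scaleD //.
  case: k IHk w fw t => [|k] IHk w fw t.
    have [Z [{}t ->]] := vconsP t; rewrite !ext_d_deg0 connD // connM //.
    rewrite big_ord_recl big_ord0 scale1r vcons0 tdel0 [in RHS]scalerBr.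
    by zmod.
  by rewrite ext_d_scaleD [in RHS]scalerBr; zmod.
- have [Y [{}t ->]] := vconsP t => i0.
  rewrite (_ : i = ord0) ?vcons0 => [->|]; last exact: val_inj.
  rewrite cartan // contr_lieD.
  case: k IHk w fw t {i i0} => [|k] IHk w fw t.
    by rewrite ext_d_deg0 lieD_deg0 lieXX form_cons0 //; zmod.
  rewrite cartan; last exact: form_contr.
  rewrite contr_contr //.
  rewrite lieXX form_cons0 // subr0 subKr.
  by rewrite ext_d0.
Qed.

Section Flat.
Hypothesis DF : is_flat.

(** Both sides have the same commutator with contractions, by the Jacobi
identity for vector fields; in degree [0] this is flatness. *)
Lemma lieD_comm k X Y (w : cochain k E) t : is_form w ->
  lieD X (lieD Y w) t - lieD Y (lieD X w) t = lieD (lie X Y) w t.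
Proof.
elim: k w t => [|k IHk] w t fw; first by rewrite !lieD_deg0 DF.
have [Z [{}t ->]] := vconsP t; rewrite !contr_lieD.
have cE X' Y' : contr Y' (lieD X' w)
    = fun t => lieD X' (contr Y' w) t - contr (lie X' Y') w t.
  by apply/funext => s; rewrite /contr contr_lieD.
rewrite !cE (lieDB X (lieD Y _)) (lieDB Y (lieD X _)).
rewrite -(IHk _ _ (form_contr Z fw)) (lie_jacobi X Y Z) form_consD //.
by rewrite /contr; zmod.
Qed.

Lemma lieD_ext_d k X (w : cochain k E) t : is_form w ->
  lieD X (ext_d D w) t = ext_d D (lieD X w) t.
Proof.
elim: k w t => [|k IHk] w t fw; have [Y [{}t ->]] := vconsP t.
  rewrite contr_lieD contr_ext_d0 !ext_d_deg0 !lieD_deg0 DF.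
  by rewrite subKr.
rewrite contr_lieD contr_ext_d // lieDB IHk; last exact: form_contr.
rewrite !cartan //; last exact: form_lieD.
rewrite (_ : contr Y (lieD X w)
    = fun t => lieD X (contr Y w) t - contr (lie X Y) w t).
  by rewrite ext_dB -lieD_comm //; zmod.
by apply/funext => s; rewrite /contr contr_lieD.
Qed.

(** By Cartan's formula [i_X d d w] is [L_X d w - d (i_X d w)], that is
[L_X d w - d L_X w + d d (i_X w)]; [d] commutes with [L_X], and induction
takes care of the last term. *)
Lemma ext_dd k (w : cochain k E) t : is_form w -> ext_d D (ext_d D w) t = 0.
Proof.
elim: k w t => [|k IHk] w t fw; have [Y [{}t ->]] := vconsP t;
  rewrite cartan ?lieD_ext_d //; try exact: form_ext_d.
  by rewrite contr_ext_d0 subrr.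
by rewrite contr_ext_d // ext_dB IHk ?subr0 ?subrr //; exact: form_contr.
Qed.

End Flat.
End Cartan.

(** * Alternation and exterior products *)

Section Constants.
Variables (R : realType) (M : manifold R).

Lemma scst1 : scst M 1 = 1.
Proof. exact: val_inj. Qed.

Lemma scstD a b : scst M (a + b) = scst M a + scst M b.
Proof. exact: val_inj. Qed.

Lemma scstMn a n : scst M (a *+ n) = scst M a *+ n.
Proof.
by elim: n => [|n IHn]; [exact: val_inj | rewrite !mulrS scstD IHn].
Qed.

Lemma scst_divnK (V : lmodType (smoothFun M)) n (v : V) : (0 < n)%N ->
  scst M n%:R^-1 *: (v *+ n) = v.
Proof.
move=> n0; rewrite -scalerMnr scalerMnl -scstMn -[_^-1 *+ n]mulr_natr mulVf.
  by rewrite scst1 scale1r.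
by rewrite pnatr_eq0 -lt0n.
Qed.

Lemma mulrn_inj (V : lmodType (smoothFun M)) n (u v : V) : (0 < n)%N ->
  u *+ n = v *+ n -> u = v.
Proof. by move=> n0 uv; rewrite -(scst_divnK u n0) uv scst_divnK. Qed.

End Constants.

Section Alternation.
Variables (R : realType) (M : manifold R) (E : lmodType (smoothFun M)).

Definition multilinear k (w : cochain k E) : Prop :=
  forall t i (f : smoothFun M) X Y,
    w (tset t i (f *: X + Y)) = f *: w (tset t i X) + w (tset t i Y).

Definition alternation n (w : cochain n E) : cochain n E :=
  fun t => \sum_(s : 'S_n) (-1) ^+ s *: w [tuple tnth t (s i) | i < n].

Lemma alternation_is_form n (w : cochain n E) :
  multilinear w -> is_form (alternation w).
Proof.
move=> wl; split=> [t i f X Y|t i j nij tij].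
  have h (s : 'S_n) Z : [tuple tnth (tset t i Z) (s a) | a < n]
      = tset [tuple tnth t (s a) | a < n] (s^-1 i)%g Z.
    apply: eq_from_tnth => a; rewrite !tnth_mktuple.
    by rewrite (can2_eq (permK s) (permKV s)).
  rewrite /alternation scaler_sumr -big_split /=; apply: eq_bigr => s _.
  by rewrite !h wl scalerDr !scalerA mulrC.
pose u := tperm i j.
have oddMu (s : 'S_n) : (s * u)%g = ~~ s :> bool.
  by rewrite odd_permM odd_tperm nij addbT.
rewrite /alternation (bigID (@odd_perm _)) /=.
apply: canLR (subrK _) _; rewrite add0r -sumrN.
rewrite (reindex_inj (mulIg u)); apply: eq_big => //= s.
rewrite oddMu => /negPf ->; rewrite scaleN1r scale1r; congr (- w _).
apply: eq_from_tnth => a; rewrite !tnth_mktuple permM /u.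
by case: tpermP => // ->.
Qed.

(** Permutations of [n.+1] letters are sorted by the image of the first one:
[lift_perm ord0 i s] runs over those which send it to [i], and its sign is
that of [s] times [(-1) ^+ i]. *)
Lemma alternationS n (w : cochain n.+1 E) t :
  alternation w t =
  \sum_(i < n.+1) (-1) ^+ i *: alternation (contr (tnth t i) w) (tdel i t).
Proof.
pose h (p : 'I_n.+1 * 'S_n) := lift_perm ord0 p.1 p.2.
have h_inj : injective h.
  move=> [i s] [j r] e; have ij : i = j.
    by have := congr1 (fun s : 'S_n.+1 => s ord0) e; rewrite !lift_perm_id.
  rewrite {}ij in e *; congr (_, _); apply/permP => a; apply: (@lift_inj _ j).
  have := congr1 (fun s : 'S_n.+1 => s (lift ord0 a)) e.
  by rewrite !lift_perm_lift.
have h_bij : bijective h.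
  apply: (inj_card_bij h_inj).
  by rewrite card_prod card_ord !card_Sn factS.
rewrite /alternation (reindex h (onW_bij _ h_bij)) /=.
transitivity (\sum_(i < n.+1) \sum_(s : 'S_n)
  (-1) ^+ (h (i, s)) *: w [tuple tnth t (h (i, s) a) | a < n.+1]).
  by rewrite pair_big; apply: eq_bigr => [[i s]].
apply: eq_bigr => i _; rewrite scaler_sumr; apply: eq_bigr => s _.
rewrite scalerA odd_lift_perm signr_addb signr_odd; congr (_ *: w _).
apply: eq_from_tnth => a; rewrite tnth_mktuple.
case: (unliftP ord0 a) => [b ->|->].
  by rewrite lift_perm_lift vconsS !tnth_mktuple.
by rewrite lift_perm_id vcons0.
Qed.

Lemma alternation_form n (w : cochain n E) t :
  is_form w -> alternation w t = w t *+ n`!.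
Proof.
elim: n w t => [|n IHn] w t fw.
  rewrite /alternation (big_pred1 1%g) => [|s]; last first.
    by apply/esym/eqP/permP => -[].
  by rewrite odd_perm1 scale1r mulr1n (tuple0 t) (tuple0 [tuple _ | _ < _]).
rewrite alternationS.
under eq_bigr => i _.
  rewrite IHn; last exact: form_contr.
  rewrite /contr form_move // tset_id -scalerMnr scalerA -expr2 sqrr_sign.
  rewrite scale1r. over.
by rewrite sumr_const card_ord -mulrnA factS mulnC.
Qed.

End Alternation.

Section Wedge.
Variables (R : realType) (M : manifold R) (E F : lmodType (smoothFun M)).
Variable S : E -> F -> (smoothFun M)^o.

Record is_bilinear : Prop := IsBilinear {
  bil_l : forall (f : smoothFun M) u v m,
    S (f *: u + v) m = f *: S u m + S v m;
  bil_r : forall (f : smoothFun M) u m n,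
    S u (f *: m + n) = f *: S u m + S u n }.

Hypothesis SP : is_bilinear.

Lemma bilDl u v m : S (u + v) m = S u m + S v m.
Proof. by have := bil_l SP 1 u v m; rewrite !scale1r. Qed.
Lemma bilDr u m n : S u (m + n) = S u m + S u n.
Proof. by have := bil_r SP 1 u m n; rewrite !scale1r. Qed.
Lemma bil0l m : S 0 m = 0.
Proof. by apply: (addrI (S 0 m)); rewrite -bilDl !addr0. Qed.
Lemma bil0r u : S u 0 = 0.
Proof. by apply: (addrI (S u 0)); rewrite -bilDr !addr0. Qed.
Lemma bilZl f u m : S (f *: u) m = f *: S u m.
Proof. by rewrite -[f *: u]addr0 bil_l // bil0l addr0. Qed.
Lemma bilZr f u m : S u (f *: m) = f *: S u m.
Proof. by rewrite -[f *: m]addr0 bil_r // bil0r addr0. Qed.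
Lemma bilNl u m : S (- u) m = - S u m.
Proof. by rewrite -!scaleN1r bilZl. Qed.
Lemma bilNr u m : S u (- m) = - S u m.
Proof. by rewrite -!scaleN1r bilZr. Qed.

(** The wedge product is the alternation of this map, up to the factor
[1 / (k! l!)]. *)
Definition tensor k l (w : cochain k E) (p : cochain l F) :
    cochain (k + l) (smoothFun M)^o := fun t =>
  S (w [tuple tnth t (lshift l i) | i < k])
    (p [tuple tnth t (rshift k j) | j < l]).

Lemma wedgeE k l (w : cochain k E) (p : cochain l F) t :
  wedge S w p t = scst M ((k`! * l`!)%:R^-1) *: alternation (tensor w p) t.
Proof.
rewrite /wedge /alternation; congr (_ *: _); apply: eq_bigr => s _.
congr (_ *: S (w _) (p _)); apply: eq_from_tnth => i; by rewrite !tnth_mktuple.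
Qed.

Lemma tensor_multilinear k l (w : cochain k E) (p : cochain l F) :
  is_form w -> is_form p -> multilinear (tensor w p).
Proof.
move=> [wl _] [pl _] t i f X Y; rewrite /tensor.
case: (splitP i) => [a ia|a ia].
  have -> : i = lshift l a by exact: val_inj.
  have hl Z : [tuple tnth (tset t (lshift l a) Z) (lshift l b) | b < k]
     = tset [tuple tnth t (lshift l b) | b < k] a Z.
    apply: eq_from_tnth => b; rewrite !tnth_mktuple.
    by rewrite (inj_eq (@lshift_inj _ _)).
  have hr Z : [tuple tnth (tset t (lshift l a) Z) (rshift k b) | b < l]
     = [tuple tnth t (rshift k b) | b < l].
    by apply: eq_from_tnth => b; rewrite !tnth_mktuple eq_rlshift.
  by rewrite !hl !hr wl bil_l.
have -> : i = rshift k a by exact: val_inj.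
have hl Z : [tuple tnth (tset t (rshift k a) Z) (lshift l b) | b < k]
   = [tuple tnth t (lshift l b) | b < k].
  by apply: eq_from_tnth => b; rewrite !tnth_mktuple eq_lrshift.
have hr Z : [tuple tnth (tset t (rshift k a) Z) (rshift k b) | b < l]
   = tset [tuple tnth t (rshift k b) | b < l] a Z.
  apply: eq_from_tnth => b; rewrite !tnth_mktuple.
  by rewrite (inj_eq (@rshift_inj _ _)).
by rewrite !hl !hr pl bil_r.
Qed.

Lemma wedge_is_form k l (w : cochain k E) (p : cochain l F) :
  is_form w -> is_form p -> is_form (wedge S w p).
Proof.
move=> fw fp; set c := scst M ((k`! * l`!)%:R^-1).
have := form_scaleD c
  (alternation_is_form (tensor_multilinear fw fp)) (@form_zero _ _ _ _).
by congr is_form; apply/funext => t; rewrite addr0 wedgeE.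
Qed.

Lemma contr_tensor k l (w : cochain k.+1 E) (p : cochain l F) X :
  @contr _ _ _ (k + l) X (tensor w p) = tensor (contr X w) p.
Proof.
apply/funext => t; rewrite /contr /tensor; congr (S (w _) (p _)).
  apply: eq_from_tnth => i; rewrite tnth_mktuple.
  case: (unliftP ord0 i) => [a ->|->]; last first.
    by rewrite (_ : lshift l ord0 = ord0 :> 'I_(k + l).+1) //; exact: val_inj.
  have -> : lshift l (lift ord0 a) = lift ord0 (lshift l a) :> 'I_(k + l).+1.
    exact: val_inj.
  by rewrite !vconsS tnth_mktuple.
apply: eq_from_tnth => i; rewrite !tnth_mktuple.
have -> : rshift k.+1 i = lift ord0 (rshift k i) :> 'I_(k + l).+1.
  exact: val_inj.
by rewrite vconsS.
Qed.

(** The expansion of a wedge product along its left factor.  Iterating it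
replaces the sum over permutations by a sum over shuffles. *)
Lemma wedge_recl k l (w : cochain k.+1 E) (p : cochain l F) t :
  wedge S w p t *+ k.+1 =
  \sum_(i < (k + l).+1)
    (-1) ^+ i *: wedge S (contr (tnth t i) w) p (tdel i t).
Proof.
rewrite wedgeE (@alternationS _ _ _ (k + l)) scalerMnl -scstMn.
have -> : ((k.+1)`! * l`!)%:R^-1 *+ k.+1 = (k`! * l`!)%:R^-1 :> R.
  rewrite factS -mulnA natrM invfM -mulrnAl.
  by rewrite -[_^-1 *+ _]mulr_natl divff ?mul1r // pnatr_eq0.
rewrite scaler_sumr; apply: eq_bigr => i _.
by rewrite contr_tensor wedgeE !scalerA mulrC.
Qed.

(** The [l!] permutations of the arguments of a form all contribute the same
value, so the normalization of the wedge product leaves one copy. *)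
Lemma wedge0l l (w : cochain 0 E) (p : cochain l F) t :
  is_form p -> wedge S w p t = S (w [tuple]) (p t).
Proof.
move=> fp; rewrite wedgeE.
have -> : tensor w p = fun t => S (w [tuple]) (p t).
  apply/funext => s; rewrite /tensor (tuple0 [tuple _ | _ < _]).
  congr (S _ (p _)).
  apply: eq_from_tnth => i; rewrite tnth_mktuple; congr tnth; exact: val_inj.
have fs : is_form (fun t => S (w [tuple]) (p t)).
  have [pl pa] := fp; split=> [s i f X Y|s i j nij sij].
    by rewrite pl bil_r.
  by rewrite (pa _ _ _ nij sij) bil0r.
by rewrite alternation_form // mul1n scst_divnK // fact_gt0.
Qed.

End Wedge.

Section SmallTuples.
Variables (R : realType) (M : manifold R).
Implicit Types (X Y Z T : vectorField M).

Lemma tuple1E X : [tuple X] = (X ::: [tuple]).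
Proof. by []. Qed.
Lemma tuple2E X Y : [tuple X; Y] = (X ::: Y ::: [tuple]).
Proof. by []. Qed.
Lemma tuple3E X Y Z : [tuple X; Y; Z] = (X ::: Y ::: Z ::: [tuple]).
Proof. by []. Qed.
Lemma tuple4E X Y Z T : [tuple X; Y; Z; T] = (X ::: Y ::: Z ::: T ::: [tuple]).
Proof. by []. Qed.
Lemma tuple5E X Y Z T U :
  [tuple X; Y; Z; T; U] = (X ::: Y ::: Z ::: T ::: U ::: [tuple]).
Proof. by []. Qed.

Lemma tuple1P (t : 1.-tuple (vectorField M)) : exists X, t = [tuple X].
Proof. by have [X [{}t ->]] := vconsP t; rewrite (tuple0 t); exists X. Qed.
Lemma tuple2P (t : 2.-tuple (vectorField M)) : exists X Y, t = [tuple X; Y].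
Proof.
have [X [{}t ->]] := vconsP t; have [Y ->] := tuple1P t; by exists X, Y.
Qed.
Lemma tuple3P (t : 3.-tuple (vectorField M)) :
  exists X Y Z, t = [tuple X; Y; Z].
Proof.
have [X [{}t ->]] := vconsP t; have [Y [Z ->]] := tuple2P t; by exists X, Y, Z.
Qed.
Lemma tuple5P (t : 5.-tuple (vectorField M)) :
  exists X Y Z T U, t = [tuple X; Y; Z; T; U].
Proof.
have [X [{}t ->]] := vconsP t; have [Y [{}t ->]] := vconsP t.
by have [Z [T [U ->]]] := tuple3P t; exists X, Y, Z, T, U.
Qed.

(** With [lift0_lift], it evaluates the indices left by expanding a sum over
positions. *)
Lemma liftS0 k (i : 'I_k.+1) : lift (lift ord0 i) ord0 = ord0 :> 'I_k.+2.
Proof. exact: val_inj. Qed.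

Lemma sign_lift k (i : 'I_k) (V : lmodType (smoothFun M)) (v : V) :
  (-1) ^+ (lift ord0 i) *: v = - ((-1) ^+ i *: v).
Proof. by rewrite lift0 exprS mulN1r scaleNr. Qed.

Lemma sign_ord0 k (V : lmodType (smoothFun M)) (v : V) :
  (-1) ^+ (ord0 : 'I_k.+1) *: v = v.
Proof. by rewrite scale1r. Qed.

Lemma form2C (V : lmodType (smoothFun M)) (w : cochain 2 V) X Y : is_form w ->
  w [tuple X; Y] = - w [tuple Y; X].
Proof. exact: form_swap. Qed.

End SmallTuples.

Definition vcons_simp := (vcons0, vconsS, tdel0, tdelS, tset0, tsetS).

(** Iterating Cartan's formula gives the differentials in low degree with every
bracket in the place of the later of its two entries. *)
Section SmallDifferentials.
Variables (R : realType) (M : manifold R) (E : lmodType (smoothFun M)).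
Variable D : vectorField M -> E -> E.
Implicit Types (X Y Z T U : vectorField M).

Lemma ext_d1E (w : cochain 1 E) X Y : is_form w ->
  ext_d D w [tuple X; Y] =
  D X (w [tuple Y]) - D Y (w [tuple X]) - w [tuple lie X Y].
Proof.
move=> fw; rewrite tuple2E cartan // ext_d_deg0 /lieD !big_ord_recl big_ord0.
by rewrite /contr !vcons_simp !tuple1E; zmod.
Qed.

Lemma ext_d2E (w : cochain 2 E) X Y Z : is_form w ->
  ext_d D w [tuple X; Y; Z] =
  D X (w [tuple Y; Z]) - D Y (w [tuple X; Z]) + D Z (w [tuple X; Y])
  - w [tuple lie X Y; Z] - w [tuple Y; lie X Z] + w [tuple X; lie Y Z].
Proof.
move=> fw; rewrite tuple3E cartan // -tuple2E ext_d1E; last exact: form_contr.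
by rewrite /lieD !big_ord_recl big_ord0 !vcons_simp /contr; zmod.
Qed.

Lemma ext_d3E (w : cochain 3 E) X Y Z T : is_form w ->
  ext_d D w [tuple X; Y; Z; T] =
  D X (w [tuple Y; Z; T]) - D Y (w [tuple X; Z; T]) + D Z (w [tuple X; Y; T])
  - D T (w [tuple X; Y; Z])
  - w [tuple lie X Y; Z; T] - w [tuple Y; lie X Z; T] - w [tuple Y; Z; lie X T]
  + w [tuple X; lie Y Z; T] + w [tuple X; Z; lie Y T] - w [tuple X; Y; lie Z T].
Proof.
move=> fw; rewrite tuple4E cartan // -tuple3E ext_d2E; last exact: form_contr.
by rewrite /lieD !big_ord_recl big_ord0 !vcons_simp /contr; zmod.
Qed.

Lemma ext_d4E (w : cochain 4 E) X Y Z T U : is_form w ->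
  ext_d D w [tuple X; Y; Z; T; U] =
  D X (w [tuple Y; Z; T; U]) - D Y (w [tuple X; Z; T; U])
  + D Z (w [tuple X; Y; T; U]) - D T (w [tuple X; Y; Z; U])
  + D U (w [tuple X; Y; Z; T])
  - w [tuple lie X Y; Z; T; U] - w [tuple Y; lie X Z; T; U]
  - w [tuple Y; Z; lie X T; U] - w [tuple Y; Z; T; lie X U]
  + w [tuple X; lie Y Z; T; U] + w [tuple X; Z; lie Y T; U]
  + w [tuple X; Z; T; lie Y U]
  - w [tuple X; Y; lie Z T; U] - w [tuple X; Y; T; lie Z U]
  + w [tuple X; Y; Z; lie T U].
Proof.
move=> fw; rewrite tuple5E cartan // -tuple4E ext_d3E; last exact: form_contr.
by rewrite /lieD !big_ord_recl big_ord0 !vcons_simp /contr; zmod.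
Qed.

End SmallDifferentials.

Section SmallWedges.
Variables (R : realType) (M : manifold R) (E F : lmodType (smoothFun M)).
Implicit Types (X Y Z T U : vectorField M).
Variable S : E -> F -> (smoothFun M)^o.
Hypothesis SP : is_bilinear S.

(** Each shuffle of the two arguments of [w] is counted twice. *)
Lemma wedge2E l (w : cochain 2 E) (p : cochain l F) t :
  is_form w -> is_form p ->
  wedge S w p t *+ 2 =
  \sum_(i < l.+2) \sum_(j < l.+1) (-1) ^+ i *: ((-1) ^+ j *:
    S (w [tuple tnth t i; tnth t (lift i j)]) (p (tdel j (tdel i t)))).
Proof.
move=> fw fp; rewrite (wedge_recl _ w p); apply: eq_bigr => i _.
have := wedge_recl S (contr (tnth t i) w) p (tdel i t); rewrite mulr1n => ->.
rewrite scaler_sumr; apply: eq_bigr => j _.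
by rewrite wedge0l // tnth_mktuple.
Qed.

Lemma wedge22E (w : cochain 2 E) (p : cochain 2 F) X Y Z T :
  is_form w -> is_form p ->
  wedge S w p [tuple X; Y; Z; T] =
  S (w [tuple X; Y]) (p [tuple Z; T]) - S (w [tuple X; Z]) (p [tuple Y; T])
  + S (w [tuple X; T]) (p [tuple Y; Z]) + S (w [tuple Y; Z]) (p [tuple X; T])
  - S (w [tuple Y; T]) (p [tuple X; Z]) + S (w [tuple Z; T]) (p [tuple X; Y]).
Proof.
move=> fw fp; apply: (@mulrn_inj _ _ _ 2) => //.
rewrite wedge2E // !big_ord_recl !big_ord0 !lift0_lift !liftS0.
rewrite !sign_lift !sign_ord0 tuple4E !vcons_simp.
rewrite (form2C Y X) // (form2C Z X) // (form2C T X) // (form2C Z Y) //.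
by rewrite (form2C T Y) // (form2C T Z) // !(bilNl SP) mulr2n; zmod.
Qed.

Lemma wedge23E (w : cochain 2 E) (p : cochain 3 F) X Y Z T U :
  is_form w -> is_form p ->
  wedge S w p [tuple X; Y; Z; T; U] =
    S (w [tuple X; Y]) (p [tuple Z; T; U])
  - S (w [tuple X; Z]) (p [tuple Y; T; U])
  + S (w [tuple X; T]) (p [tuple Y; Z; U])
  - S (w [tuple X; U]) (p [tuple Y; Z; T])
  + S (w [tuple Y; Z]) (p [tuple X; T; U])
  - S (w [tuple Y; T]) (p [tuple X; Z; U])
  + S (w [tuple Y; U]) (p [tuple X; Z; T])
  + S (w [tuple Z; T]) (p [tuple X; Y; U])
  - S (w [tuple Z; U]) (p [tuple X; Y; T])
  + S (w [tuple T; U]) (p [tuple X; Y; Z]).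
Proof.
move=> fw fp; apply: (@mulrn_inj _ _ _ 2) => //.
rewrite wedge2E // !big_ord_recl !big_ord0 !lift0_lift !liftS0.
rewrite !sign_lift !sign_ord0 tuple5E !vcons_simp.
rewrite (form2C Y X) // (form2C Z X) // (form2C T X) // (form2C U X) //.
rewrite (form2C Z Y) // (form2C T Y) // (form2C U Y) //.
rewrite (form2C T Z) // (form2C U Z) // (form2C U T) //.
by rewrite !(bilNl SP) mulr2n; zmod.
Qed.

End SmallWedges.

Section Functions.
Variables (R : realType) (M : manifold R).
Implicit Types (X Y Z T U : vectorField M).
Definition derivative X (f : (smoothFun M)^o) : (smoothFun M)^o := X f.

Lemma derivative_connection : is_connection derivative.
Proof.
split=> [f X Y e //|X e e'|X f e]; first exact: vfD.
by rewrite /derivative /= vfM.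
Qed.

Lemma d_dRE k (w : cochain k (smoothFun M)^o) : d_dR w = ext_d derivative w.
Proof. by []. Qed.

Lemma d_dR_cstZ k c (w : cochain k (smoothFun M)^o) t :
  d_dR (fun t => scst M c *: w t) t = scst M c *: d_dR w t.
Proof.
case: k w t => [|k] w t; first by rewrite /= vfZ.
have -> : (fun t => scst M c *: w t) = fun t => scst M c *: w t + 0.
  by apply/funext => s; rewrite addr0.
rewrite !d_dRE (ext_d_scaleD derivative_connection) big1 => [|i _].
  by rewrite (ext_d0 derivative_connection) !addr0.
by rewrite vf_cst scale0r scaler0.
Qed.

Lemma derivative_flat : is_flat derivative.
Proof. by []. Qed.

End Functions.

Section Leibniz.
Variables (R : realType) (M : manifold R) (E F : lmodType (smoothFun M)).
Implicit Types (X Y Z T U : vectorField M).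
Variables (S : E -> F -> (smoothFun M)^o) (SP : is_bilinear S).
Variables (D : vectorField M -> E -> E) (D' : vectorField M -> F -> F).
Hypotheses (DP : is_connection D) (DP' : is_connection D').
Hypothesis SD : forall X u m,
  X (S u m) = S (D X u) m + S u (D' X m) :> (smoothFun M)^o.

(** The wedge of a 3-form and a 2-form equals the wedge in the other order for
the flipped pairing, so that products of type (2, 3) are enough to state the
Leibniz rule. *)
Lemma bilinear_flip : is_bilinear (fun m u => S u m).
Proof. by case: SP. Qed.

(** Both sides are expanded into values on the five fields; the compatibility
of the pairing with [D] and [D'] matches the derivatives and the brackets
already correspond term by term. *)
Lemma d_wedge22 (w : cochain 2 E) (p : cochain 2 F) t :
  is_form w -> is_form p ->
  d_dR (wedge S w p) t = wedge (fun m u => S u m) p (ext_d D w) t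
                         + wedge S w (ext_d D' p) t.
Proof.
move=> fw fp; have [X [Y [Z [T [U ->]]]]] := tuple5P t.
rewrite (wedge23E SP) //; last exact: form_ext_d.
rewrite (wedge23E bilinear_flip) //; last exact: form_ext_d.
rewrite d_dRE (ext_d4E (@derivative R M)); last exact: (wedge_is_form SP fw fp).
rewrite !(ext_d2E D) // !(ext_d2E D') // !(wedge22E SP) //.
rewrite /derivative !vfD !vf_mapN !SD.
rewrite !(bilDl SP, bilNl SP, bilDr SP, bilNr SP).
zmod.
Qed.

End Leibniz.

(** * Differentiation of sections of trivial bundles *)

Section TrivialBundle.
Variables (R : realType) (M : manifold R) (V : vectType R).
Implicit Types (X Y : vectorField M) (s t : smoothSec M V) (f : smoothFun M).

Lemma sec_coordD s t i : sec_coord (s + t) i = sec_coord s i + sec_coord t i.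
Proof. by apply/val_inj/funext => x; rewrite /= linearD. Qed.

Lemma sec_coordZ f s i : sec_coord (f *: s) i = f * sec_coord s i.
Proof. by apply/val_inj/funext => x; rewrite /= linearZ. Qed.

Lemma sec_coord_csec v i :
  sec_coord (csec M v) i = scst M (coord (vbasis {:V}) i v).
Proof. exact: val_inj. Qed.

Lemma sec_coord_eq s t : (forall i, sec_coord s i = sec_coord t i) -> s = t.
Proof.
move=> st; apply: smoothSec_eq => x.
rewrite [s x](coord_vbasis (memvf _)) [t x](coord_vbasis (memvf _)).
apply: eq_bigr => i _; congr (_ *: _).
by have := congr1 (fun f : smoothFun M => f x) (st i).
Qed.

Lemma sec_coord0 i : sec_coord (0 : smoothSec M V) i = 0.
Proof. by apply: (addrI (sec_coord 0 i)); rewrite -sec_coordD !addr0. Qed.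

Lemma sec_coord_sum I (r : seq I) (P : pred I) (F : I -> smoothSec M V) i :
  sec_coord (\sum_(j <- r | P j) F j) i = \sum_(j <- r | P j) sec_coord (F j) i.
Proof.
exact: (big_morph (fun s => sec_coord s i) (fun s t => sec_coordD s t i)
                  (sec_coord0 i)).
Qed.

Lemma sec_coord_basis (F : 'I_(\dim {:V}) -> smoothFun M) i :
  sec_coord (\sum_j F j *: csec M (vbasis {:V})`_j) i = F i.
Proof.
rewrite sec_coord_sum (bigD1 i) //= big1 => [|j nji];
  rewrite sec_coordZ sec_coord_csec coord_free ?(basis_free (vbasisP _)) //.
  by rewrite eqxx scst1 mulr1 addr0.
by rewrite (negbTE nji) (_ : scst M 0 = 0) ?mulr0 //; exact: val_inj.
Qed.

Lemma sec_basisE s : s = \sum_i sec_coord s i *: csec M (vbasis {:V})`_i.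
Proof. by apply: sec_coord_eq => i; rewrite sec_coord_basis. Qed.

Lemma sec_coord_Lder X s i : sec_coord (Lder X s) i = X (sec_coord s i).
Proof. exact: sec_coord_basis. Qed.

Lemma Lder_connection : is_connection (@Lder R M V).
Proof.
split=> [f X Y s|X s t|X f s]; apply: sec_coord_eq => i;
  rewrite !(sec_coordD, sec_coordZ, sec_coord_Lder) //.
- by rewrite vfD.
- by rewrite vfM.
Qed.

Lemma Lder_flat : is_flat (@Lder R M V).
Proof.
move=> X Y s; apply: sec_coord_eq => i.
by rewrite sec_coordD -scaleN1r sec_coordZ !sec_coord_Lder mulN1r.
Qed.

Lemma Lder_csec X (v : V) : Lder X (csec M v) = 0.
Proof.
apply: sec_coord_eq => i.
by rewrite sec_coord_Lder sec_coord_csec vf_cst sec_coord0.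
Qed.

End TrivialBundle.

Section Fibrewise.
Variables (R : realType) (M : manifold R) (U V W : vectType R).
Implicit Types (X Y : vectorField M) (f : smoothFun M).

Lemma lift1D (F : 'Hom(V, W)) (s t : smoothSec M V) :
  lift1 F (s + t) = lift1 F s + lift1 F t.
Proof. by apply: smoothSec_eq => x; rewrite /= linearD. Qed.

Lemma lift1Z (F : 'Hom(V, W)) f (s : smoothSec M V) :
  lift1 F (f *: s) = f *: lift1 F s.
Proof. by apply: smoothSec_eq => x; rewrite /= linearZ. Qed.

Lemma lift1_sum (F : 'Hom(V, W)) I (r : seq I) (P : pred I)
    (G : I -> smoothSec M V) :
  lift1 F (\sum_(j <- r | P j) G j) = \sum_(j <- r | P j) lift1 F (G j).
Proof.
apply: (big_morph _ (lift1D F)).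
by apply: (addrI (lift1 F 0)); rewrite -lift1D !addr0.
Qed.

Lemma lift1_csec (F : 'Hom(V, W)) v : lift1 F (csec M v) = csec M (F v).
Proof. exact: smoothSec_eq. Qed.

(** A fibrewise linear map has constant coefficients, hence it commutes with
differentiation; expanding the section in the constant basis sections reduces
this to [Lder_csec]. *)
Lemma Lder_lift1 X (F : 'Hom(V, W)) (s : smoothSec M V) :
  Lder X (lift1 F s) = lift1 F (Lder X s).
Proof.
rewrite [in LHS](sec_basisE s) [in RHS]/Lder !lift1_sum.
rewrite (conn_sum (Lder_connection M W)).
apply: eq_bigr => i _; rewrite !lift1Z lift1_csec (connM (Lder_connection M W)).
by rewrite Lder_csec scaler0 add0r.
Qed.

Lemma lift2Dl (B : 'Hom(U, 'Hom(V, W))) (s s' : smoothSec M U) t :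
  lift2 B (s + s') t = lift2 B s t + lift2 B s' t.
Proof. by apply: smoothSec_eq => x; rewrite /= linearD add_lfunE. Qed.

Lemma lift2Dr (B : 'Hom(U, 'Hom(V, W))) (s : smoothSec M U) t t' :
  lift2 B s (t + t') = lift2 B s t + lift2 B s t'.
Proof. by apply: smoothSec_eq => x; rewrite /= linearD. Qed.

Lemma lift2Zl (B : 'Hom(U, 'Hom(V, W))) f (s : smoothSec M U) t :
  lift2 B (f *: s) t = f *: lift2 B s t.
Proof. by apply: smoothSec_eq => x; rewrite /= linearZ scale_lfunE. Qed.

Lemma lift2Zr (B : 'Hom(U, 'Hom(V, W))) f (s : smoothSec M U) t :
  lift2 B s (f *: t) = f *: lift2 B s t.
Proof. by apply: smoothSec_eq => x; rewrite /= linearZ. Qed.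

Lemma lift2Nl (B : 'Hom(U, 'Hom(V, W))) (s : smoothSec M U) t :
  lift2 B (- s) t = - lift2 B s t.
Proof. by rewrite -!scaleN1r lift2Zl. Qed.

Lemma lift2Nr (B : 'Hom(U, 'Hom(V, W))) (s : smoothSec M U) t :
  lift2 B s (- t) = - lift2 B s t.
Proof. by rewrite -!scaleN1r lift2Zr. Qed.

Lemma lift2_suml (B : 'Hom(U, 'Hom(V, W))) I (r : seq I) (P : pred I)
    (G : I -> smoothSec M U) t :
  lift2 B (\sum_(j <- r | P j) G j) t = \sum_(j <- r | P j) lift2 B (G j) t.
Proof.
apply: (big_morph (fun s => lift2 B s t) (fun s s' => lift2Dl B s s' t)).
by apply: (addrI (lift2 B 0 t)); rewrite -lift2Dl !addr0.
Qed.

Lemma lift2_csec (B : 'Hom(U, 'Hom(V, W))) u (t : smoothSec M V) :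
  lift2 B (csec M u) t = lift1 (B u) t.
Proof. exact: smoothSec_eq. Qed.

Lemma Lder_lift2 X (B : 'Hom(U, 'Hom(V, W))) (s : smoothSec M U) t :
  Lder X (lift2 B s t) = lift2 B (Lder X s) t + lift2 B s (Lder X t).
Proof.
rewrite [in LHS](sec_basisE s) [X in _ = _ + lift2 B X _](sec_basisE s).
rewrite [X in _ = lift2 B X _ + _]/Lder !lift2_suml.
rewrite (conn_sum (Lder_connection M W)) -big_split.
apply: eq_bigr => i _ /=.
by rewrite !lift2Zl !lift2_csec (connM (Lder_connection M W)) Lder_lift1 addrC.
Qed.

Lemma lift20l (B : 'Hom(U, 'Hom(V, W))) (t : smoothSec M V) :
  lift2 B (0 : smoothSec M U) t = 0.
Proof. by apply: (addrI (lift2 B 0 t)); rewrite -lift2Dl !addr0. Qed.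

Lemma lift20r (B : 'Hom(U, 'Hom(V, W))) (s : smoothSec M U) :
  lift2 B s (0 : smoothSec M V) = 0.
Proof. by apply: (addrI (lift2 B s 0)); rewrite -lift2Dr !addr0. Qed.

End Fibrewise.

Section Functions.
Variables (R : realType) (M : manifold R).

Lemma fun_of_secD (s t : smoothSec M R^o) :
  fun_of_sec (s + t) = fun_of_sec s + fun_of_sec t.
Proof. exact: val_inj. Qed.

Lemma fun_of_secZ f (s : smoothSec M R^o) :
  fun_of_sec (f *: s) = f * fun_of_sec s.
Proof. exact: val_inj. Qed.

Lemma fun_of_sec_sum I (r : seq I) (P : pred I) (F : I -> smoothSec M R^o) :
  fun_of_sec (\sum_(j <- r | P j) F j) = \sum_(j <- r | P j) fun_of_sec (F j).
Proof. by apply: (big_morph _ fun_of_secD); exact: val_inj. Qed.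

Lemma vf_fun_of_sec (X : vectorField M) (s : smoothSec M R^o) :
  X (fun_of_sec s) = fun_of_sec (Lder X s).
Proof.
rewrite [in LHS](sec_basisE s) [in RHS]/Lder !fun_of_sec_sum.
rewrite (big_morph X (vfD X) (vf_map0 X)); apply: eq_bigr => i _.
rewrite !fun_of_secZ vfM.
rewrite (_ : fun_of_sec _ = scst M (vbasis {:R^o})`_i); last exact: val_inj.
by rewrite vf_cst mulr0 add0r.
Qed.

End Functions.

(** * Connections with values in a Lie algebra *)

Section LowDegreeForms.
Variables (R : realType) (M : manifold R) (E : lmodType (smoothFun M)).
Implicit Types (X Y Z : vectorField M) (f : smoothFun M).

Lemma form1DZ (w : cochain 1 E) f X Y : is_form w ->
  w [tuple f *: X + Y] = f *: w [tuple X] + w [tuple Y].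
Proof. by move=> fw; rewrite !tuple1E form_consDZ. Qed.

Lemma form2DZl (w : cochain 2 E) f X Y Z : is_form w ->
  w [tuple f *: X + Y; Z] = f *: w [tuple X; Z] + w [tuple Y; Z].
Proof. by move=> fw; rewrite !tuple2E form_consDZ. Qed.

Lemma form2DZr (w : cochain 2 E) f X Y Z : is_form w ->
  w [tuple Z; f *: X + Y] = f *: w [tuple Z; X] + w [tuple Z; Y].
Proof. by move=> fw; exact: (form1DZ f X Y (form_contr Z fw)). Qed.

Lemma form2_0r (w : cochain 2 E) X : is_form w -> w [tuple X; 0] = 0.
Proof. by move=> fw; exact: (form_cons0 (form_contr X fw)). Qed.

Lemma form3DZr (w : cochain 3 E) f X Y Z T : is_form w ->
  w [tuple Z; T; f *: X + Y] = f *: w [tuple Z; T; X] + w [tuple Z; T; Y].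
Proof. by move=> fw; exact: (form2DZr f X Y T (form_contr Z fw)). Qed.

Lemma form1_of (a : vectorField M -> E) :
  (forall f X Y, a (f *: X + Y) = f *: a X + a Y) ->
  is_form (fun t : 1.-tuple (vectorField M) => a (thead t)).
Proof.
move=> al; apply/is_formS; split=> [X|f X Y t|X t []//]; first exact: form_deg0.
by rewrite !theadE al.
Qed.

Lemma form2_of (a : vectorField M -> vectorField M -> E) :
  (forall f X Y Z, a (f *: X + Y) Z = f *: a X Z + a Y Z) ->
  (forall X Y, a X Y = - a Y X) ->
  is_form (fun t : 2.-tuple (vectorField M) => a t`_0 t`_1).
Proof.
move=> al aC; apply/is_formS; split=> [X|f X Y t|X t i].
- have e : contr X (fun t : 2.-tuple (vectorField M) => a t`_0 t`_1)
      = fun t => a X (thead t).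
    by apply/funext => t; have [Y ->] := tuple1P t.
  rewrite e; apply: form1_of => f Y' Z.
  by rewrite aC al opprD -scalerN -!aC.
- by have [Z ->] := tuple1P t; exact: al.
- have [Z ->] := tuple1P t => _; rewrite (ord1 i) => e.
  have {e} -> : Z = X := e.
  apply: (@mulrn_inj _ _ _ 2) => //; rewrite mul0rn mulr2n.
  by apply/eqP; rewrite addr_eq0; apply/eqP/aC.
Qed.

End LowDegreeForms.

(** The derivative [d + r_a] twisted by a representation [r] is used for the
adjoint representation on [h0] and for the action [phi] on [h1]. *)
Section RepresentationConnection.
Variables (R : realType) (h : lie_algebra R) (W : vectType R) (M : manifold R).
Variable r : 'Hom(h, 'Hom(W, W)).
Hypothesis r_br : forall u v w, r (la_br h u v) w = r u (r v w) - r v (r u w).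
Variable a : cochain 1 (smoothSec M h).
Hypothesis fa : is_form a.
Implicit Types (X Y Z : vectorField M).

Definition covd X (w : smoothSec M W) : smoothSec M W :=
  Lder X w + lift2 r (a [tuple X]) w.

Lemma covd_connection : is_connection covd.
Proof.
have LP := Lder_connection M W.
split=> [f X Y w|X v w|X f w]; rewrite /covd.
- by rewrite (conn_vf LP) form1DZ // lift2Dl lift2Zl scalerDr; zmod.
- by rewrite (connD LP) lift2Dr; zmod.
- by rewrite (connM LP) lift2Zr scalerDr; zmod.
Qed.

(** The curvature [d a + 1/2 [a, a]]: the bracket of [a] with itself takes the
value [2 [a X, a Y]], which absorbs the factor [1/2]. *)
Definition curv_of : cochain 2 (smoothSec M h) := fun t =>
  d_sec a t + lift2 (la_br h) (a [tuple t`_0]) (a [tuple t`_1]).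

Lemma lift2_rep u v w :
  lift2 r (lift2 (la_br h) u v) w
  = lift2 r u (lift2 r v w) - lift2 r v (lift2 r u w) :> smoothSec M W.
Proof. by apply: smoothSec_eq => x; rewrite /= r_br. Qed.

Lemma curv_ofE X Y : curv_of [tuple X; Y] =
  Lder X (a [tuple Y]) - Lder Y (a [tuple X]) - a [tuple lie X Y]
  + lift2 (la_br h) (a [tuple X]) (a [tuple Y]).
Proof. by rewrite /curv_of /d_sec ext_d1E. Qed.

Lemma covd_curvature X Y w :
  covd (lie X Y) w = covd X (covd Y w) - covd Y (covd X w)
    - lift2 r (curv_of [tuple X; Y]) w.
Proof.
have LP := Lder_connection M W.
rewrite curv_ofE /covd !(connD LP) !Lder_lift2 (Lder_flat X Y w).
by rewrite !(lift2Dl, lift2Nl, lift2Dr, lift2Nr) lift2_rep; zmod.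
Qed.

End RepresentationConnection.

Lemma covd_lift2 (R : realType) (h : lie_algebra R) (W : vectType R)
    (M : manifold R) (r : 'Hom(h, 'Hom(W, W)))
    (r_br : forall u v w, r (la_br h u v) w = r u (r v w) - r v (r u w))
    (a : cochain 1 (smoothSec M h)) X u w :
  covd r a X (lift2 r u w)
  = lift2 r (covd (la_br h) a X u) w + lift2 r u (covd r a X w).
Proof. by rewrite /covd Lder_lift2 lift2Dl lift2Dr (lift2_rep r_br); zmod. Qed.

Section AdjointConnection.
Variables (R : realType) (h : lie_algebra R) (M : manifold R).
Variable a : cochain 1 (smoothSec M h).
Hypothesis fa : is_form a.
Implicit Types (X Y Z : vectorField M) (u v w : smoothSec M h).
Local Notation br := (lift2 (la_br h)).

Lemma brC u v : br u v = - br v u.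
Proof.
apply: smoothSec_eq => x; apply/eqP; rewrite -addr_eq0 /=.
have := la_alt (u x + v x); rewrite !linearD /= !add_lfunE !la_alt /=.
by rewrite add0r addr0 addrC => ->.
Qed.

Lemma br_jacobi u v w : br u (br v w) = br (br u v) w + br v (br u w).
Proof. by apply: smoothSec_eq => x; rewrite /= la_jacobi. Qed.

Lemma ad_br (u v w : h) :
  la_br h (la_br h u v) w = la_br h u (la_br h v w) - la_br h v (la_br h u w).
Proof. by rewrite la_jacobi addrK. Qed.

Lemma curv_of_form : is_form (curv_of a).
Proof.
have fb : is_form (fun t : 2.-tuple (vectorField M) =>
    br (a [tuple t`_0]) (a [tuple t`_1])).
  apply: (form2_of (a := fun X Y => br (a [tuple X]) (a [tuple Y]))).
    by move=> f X Y Z; rewrite form1DZ // lift2Dl lift2Zl.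
  by move=> X Y; exact: brC.
have := form_scaleD 1 (form_ext_d (Lder_connection M h) fa) fb.
by congr is_form; apply/funext => t; rewrite scale1r.
Qed.

(** Second derivatives of [a] cancel by flatness of [Lder], brackets of vector
fields by their Jacobi identity, and the cubic terms by that of [h]. *)
Lemma bianchi t : ext_d (covd (la_br h) a) (curv_of a) t = 0.
Proof.
have [X [Y [Z ->]]] := tuple3P t; have LP := Lder_connection M h.
rewrite ext_d2E ?/covd; last exact: curv_of_form.
rewrite !curv_ofE // !(connD LP, connN LP) !Lder_lift2.
rewrite (Lder_flat X Y) (Lder_flat X Z) (Lder_flat Y Z) (lie_jacobi X Y Z).
have aD X' Y' : a [tuple X' + Y'] = a [tuple X'] + a [tuple Y'].
  by have := form1DZ 1 X' Y' fa; rewrite !scale1r.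
rewrite aD !(lift2Dl, lift2Nl, lift2Dr, lift2Nr).
(* A normal form for brackets: [a] on the left, nested brackets on the right. *)
rewrite (br_jacobi (a [tuple X])) (brC (br _ _)).
rewrite !(brC (Lder _ _)) (brC (a [tuple lie X Y])).
by zmod.
Qed.

End AdjointConnection.

(** * Exactness of the 5-form of a connection *)

Section Exactness.
Variables (R : realType) (g : lie_crossed_module R).
Variables (S : 'Hom(h0 g, 'Hom(h1 g, R^o))) (hS : is_quadratic_strict S).
Variables (M : manifold R) (A : diff_form 1 (smoothSec M (h0 g))).
Variable B : diff_form 2 (smoothSec M (h1 g)).
Implicit Types (X Y Z : vectorField M).
Implicit Types (u v : smoothSec M (h0 g)) (m n : smoothSec M (h1 g)).

Let fA : is_form A := formP A.
Let fB : is_form B := formP B.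

Local Notation F := (curv_of A).
Local Notation D0 := (covd (la_br (h0 g)) A).
Local Notation D1 := (covd (phi g) A).
Local Notation "<[ u , m ]>" := (sec_pairing S u m).

Lemma D0_connection : is_connection D0. Proof. exact: covd_connection. Qed.
Lemma D1_connection : is_connection D1. Proof. exact: covd_connection. Qed.

Lemma fl1_covd X m : fl1 (D1 X m) = D0 X (fl1 m).
Proof.
rewrite /covd /fl1 lift1D Lder_lift1; congr (_ + _).
by apply: smoothSec_eq => x; rewrite /= psi_phi.
Qed.

Lemma fcurvE t : fcurv A B t = F t - fl1 (B t).
Proof. by rewrite /fcurv /l2_AA scst_divnK. Qed.

Lemma curvE t : curv A B t = ext_d D1 B t.
Proof.
have [X [Y [Z ->]]] := tuple3P t.
rewrite /curv /d_sec !ext_d2E // /l2_AB /= /covd.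
by rewrite /fl2_01 (form2C Z X) // lift2Nr; zmod.
Qed.

Lemma fl1_form k (w : cochain k (smoothSec M (h1 g))) :
  is_form w -> is_form (fun t => fl1 (w t)).
Proof.
move=> [wl wa]; split=> [t i f X Y|t i j nij tij].
  by rewrite wl /fl1 lift1D lift1Z.
by rewrite (wa _ _ _ nij tij); apply: (addrI (fl1 0)); rewrite -lift1D !addr0.
Qed.

Lemma fcurv_form : is_form (fcurv A B).
Proof.
have := form_sub (curv_of_form fA) (fl1_form fB).
by congr is_form; apply/funext => t; rewrite fcurvE.
Qed.

Lemma curv_form : is_form (curv A B).
Proof.
have := form_ext_d D1_connection fB.
by congr is_form; apply/funext => t; rewrite curvE.
Qed.

Lemma sec_pairing_bilinear : is_bilinear (sec_pairing (M := M) S).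
Proof.
split=> [f u v m|f u m n]; rewrite /sec_pairing.
  by rewrite lift2Dl lift2Zl fun_of_secD fun_of_secZ.
by rewrite lift2Dr lift2Zr fun_of_secD fun_of_secZ.
Qed.

Lemma sec_pairing_fl1C m n : <[fl1 m, n]> = <[fl1 n, m]>.
Proof.
by congr fun_of_sec; apply: smoothSec_eq => x; rewrite /= (qs_l1 hS).
Qed.

Lemma sec_pairing_br u v m : <[fl2_00 u v, m]> = - <[v, fl2_01 u m]>.
Proof.
apply: val_inj; apply/funext => x /=; exact: (qs_l2 hS).
Qed.

(** Invariance of [S] cancels the two terms in [A]. *)
Lemma vf_sec_pairing X u m :
  X <[u, m]> = <[D0 X u, m]> + <[u, D1 X m]> :> (smoothFun M)^o.
Proof.
rewrite /covd (bilDl sec_pairing_bilinear) (bilDr sec_pairing_bilinear).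
rewrite sec_pairing_br addrACA addNr addr0 /sec_pairing vf_fun_of_sec.
rewrite Lder_lift2.
exact: fun_of_secD.
Qed.

Definition psi_pairing m n : (smoothFun M)^o := <[fl1 m, n]>.

Lemma psi_pairing_bilinear : is_bilinear psi_pairing.
Proof.
have SP := sec_pairing_bilinear.
split=> [f m n p|f m n p]; rewrite /psi_pairing.
  by rewrite /fl1 lift1D lift1Z (bil_l SP).
by rewrite (bil_r SP).
Qed.

Lemma vf_psi_pairing X m n :
  X (psi_pairing m n)
  = psi_pairing (D1 X m) n + psi_pairing m (D1 X n) :> (smoothFun M)^o.
Proof. by rewrite /psi_pairing vf_sec_pairing fl1_covd. Qed.

(** Up to its sign, a transgression form: [S (F, B)] corrected by half the
square of [B], because [fcurv] contains [- psi B]. *)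
Definition primitive : cochain 4 (smoothFun M)^o := fun t =>
  scst M 2^-1 *: wedge psi_pairing B B t - wedge (sec_pairing S) F B t.

Lemma primitive_form : is_form primitive.
Proof.
have SP := sec_pairing_bilinear.
have fw := wedge_is_form psi_pairing_bilinear fB fB.
have fp := wedge_is_form SP (curv_of_form fA) fB.
have := form_scaleD (scst M 2^-1) fw (form_sub (@form_zero _ _ _ _) fp).
by congr is_form; apply/funext => t; rewrite sub0r.
Qed.

(** The Leibniz rule gives [S (psi B, D1 B)] twice, by symmetry of the pairing,
and [S (D0 F, B) + S (F, D1 B)], whose first term vanishes by [bianchi]. *)
Lemma d_primitive t : d_dR primitive t = connection_5form A B S t.
Proof.
have SP := sec_pairing_bilinear; have PP := psi_pairing_bilinear.
have fF := curv_of_form fA; have fH := form_ext_d D1_connection fB.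
have -> : d_dR primitive t = scst M 2^-1 *: d_dR (wedge psi_pairing B B) t
    - d_dR (wedge (sec_pairing S) F B) t.
  have h k (w p : cochain k (smoothFun M)^o) s :
      d_dR (fun t => w t - p t) s = d_dR w s - d_dR p s.
    exact: (ext_dB (derivative_connection M)).
  by rewrite h d_dR_cstZ.
have SD := vf_sec_pairing; have PD := vf_psi_pairing.
rewrite (d_wedge22 PP D1_connection D1_connection PD) //.
rewrite (d_wedge22 SP D0_connection D1_connection SD) //.
have -> : (fun m n => psi_pairing n m) = psi_pairing.
  by apply/funext => m; apply/funext => n; exact: sec_pairing_fl1C.
rewrite -mulr2n scst_divnK // [X in _ - (X + _)](_ : _ = 0) ?add0r; last first.
  rewrite /wedge big1 ?scaler0 // => s _.
  by rewrite (bianchi fA) (bil0l SP) scaler0.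
rewrite /connection_5form /wedge -scalerBr -sumrB -scalerN -sumrN.
congr (_ *: _); apply: eq_bigr => s _.
by rewrite -scalerBr -scalerN fcurvE curvE (bilDl SP (F _)) (bilNl SP) opprB.
Qed.

Definition primitive_diff_form := DiffForm primitive_form.

Lemma connection_5form_form : is_form (connection_5form A B S).
Proof.
have := form_ext_d (derivative_connection M) primitive_form.
by congr is_form; apply/funext => t; rewrite -d_primitive.
Qed.

Lemma connection_5form_cocycle : is_cocycle (connection_5form A B S).
Proof.
split=> [|t]; first exact: connection_5form_form.
have -> : connection_5form A B S = ext_d (@derivative R M) primitive.
  by apply/funext => s; rewrite -d_primitive.
exact: (ext_dd (derivative_connection M) (@derivative_flat _ _) _
               primitive_form).
Qed.

Lemma connection_5form_coboundary : is_coboundary (connection_5form A B S).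
Proof. by exists primitive_diff_form => t; rewrite d_primitive. Qed.
End Exactness.

(** * Twisting a strict Lie 2-algebra *)

Section RealLinear.
Variables (R : realType) (M : manifold R) (E F : lmodType (smoothFun M)).
Variables (f : E -> F) (fl : real_linear f).

Lemma rlinD x y : f (x + y) = f x + f y.
Proof. by have := fl 1 x y; rewrite scst1 !scale1r. Qed.

Lemma rlin0 : f 0 = 0.
Proof. by apply: (addrI (f 0)); rewrite -rlinD !addr0. Qed.

Lemma rlinN x : f (- x) = - f x.
Proof. by apply/eqP; rewrite -addr_eq0 -rlinD addNr rlin0. Qed.

End RealLinear.

(** The bracket [br] and the action [act] of a strict Lie 2-algebra are
twisted by [b]; [l3E] says that [l3] is minus the Chevalley-Eilenberg
differential of [b].  As [b] vanishes on the image of [l1], no term quadratic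
in [b] appears in [l3], and [act] is unchanged. *)
Section Twist.
Variables (R : realType) (M : manifold R) (L : lie2_data M).
Variables (br : A0 L -> A0 L -> A0 L) (b : A0 L -> A0 L -> A1 L).
Local Notation act := (@l2_01 R M L).
Local Notation l1 := (@l1 R M L).

Hypotheses (l1_lin : real_linear l1)
  (br_lin : forall x, real_linear (br x))
  (brC : forall x y, br x y = - br y x)
  (act_lin_l : forall m, real_linear (act^~ m))
  (act_lin_r : forall x, real_linear (act x))
  (b_lin : forall x, real_linear (b x))
  (bC : forall x y, b x y = - b y x).

Hypotheses (l1_act : forall x m, l1 (act x m) = br x (l1 m))
  (act_l1 : forall m n, act (l1 m) n = - act (l1 n) m)
  (br_jac : forall x y z, br x (br y z) = br (br x y) z + br y (br x z))
  (act_br : forall x y m, act (br x y) m = act x (act y m) - act y (act x m))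
  (b_l1 : forall x m, b x (l1 m) = 0).

Hypothesis l2_00E : forall x y, l2_00 x y = br x y - l1 (b x y).
Hypothesis l3E : forall x y z, l3 x y z =
  - (act x (b y z) - act y (b x z) + act z (b x y)
     - b (br x y) z - b y (br x z) + b x (br y z)).

(** The terms linear in [b] cancel because the Chevalley-Eilenberg
differential squares to zero.  The quadratic ones have the form
[act (l1 (b w x)) (b y z)] and cancel in pairs by the skew-symmetry of
[act (l1 m) n]. *)
Lemma twist_is_lie2_algebra : is_lie2_algebra L.
Proof.
have b_l1' m x : b (l1 m) x = 0 by rewrite bC b_l1 oppr0.
have br_linl y : real_linear (br^~ y).
  by move=> a x x'; rewrite brC br_lin opprD -scalerN -!brC.
have b_linl y : real_linear (b^~ y).
  by move=> a x x'; rewrite bC b_lin opprD -scalerN -!bC.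
pose lin := (rlinD l1_lin, rlinN l1_lin,
  fun x => rlinD (br_lin x), fun x => rlinN (br_lin x),
  fun x => rlinD (b_lin x), fun x => rlinN (b_lin x),
  fun x => rlinD (act_lin_r x), fun x => rlinN (act_lin_r x)).
have brDl y x x' : br (x + x') y = br x y + br x' y := rlinD (br_linl y) x x'.
have brNl y x : br (- x) y = - br x y := rlinN (br_linl y) x.
have bDl y x x' : b (x + x') y = b x y + b x' y := rlinD (b_linl y) x x'.
have bNl y x : b (- x) y = - b x y := rlinN (b_linl y) x.
have actDl m x x' : act (x + x') m = act x m + act x' m :=
  rlinD (act_lin_l m) x x'.
have actNl m x : act (- x) m = - act x m := rlinN (act_lin_l m) x.
pose linl := (brDl, brNl, bDl, bNl, actDl, actNl).
split=> //.
- by move=> x a y z; rewrite !l2_00E br_lin b_lin l1_lin scalerBr; zmod.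
- by move=> x y; rewrite !l2_00E brC bC !lin; zmod.
- move=> x y a z z'.
  rewrite !l3E !(act_lin_l, act_lin_r, b_lin, br_lin) !scalerN.
  by rewrite !(scalerDr, scalerN); zmod.
- by move=> x y z; rewrite !l3E (brC y x) (bC y x) !(lin, linl); zmod.
- move=> x y z; rewrite !l3E (brC z y) (bC z y) (bC (br x z)) (bC z).
  by rewrite !(lin, linl); zmod.
- by move=> x m; rewrite l1_act l2_00E b_l1 (rlin0 l1_lin) subr0.
- move=> x y z; rewrite l3E !l2_00E !(lin, linl) !b_l1 !b_l1' (br_jac x).
  by rewrite !l1_act (rlin0 l1_lin) (brC (l1 _)); zmod.
- move=> x y m; rewrite l3E !l2_00E !(lin, linl) -!l1_act !b_l1 (act_l1 m).
  by rewrite act_br !(rlin0 (act_lin_r _)); zmod.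
- move=> w x y z; rewrite /l2_10 !l3E !l2_00E !(lin, linl).
  rewrite !(brC (l1 _)) -!l1_act !(lin, linl) !b_l1 !b_l1'.
  rewrite !act_br (br_jac w x y) (br_jac w x z) (br_jac w y z) (br_jac x y z).
  rewrite (act_l1 (b y z)) (act_l1 (b x z)) (act_l1 (b x y)).
  by rewrite !(lin, linl) !(rlin0 (act_lin_r _)); zmod.
Qed.

End Twist.

(** * The quadratic Lie 2-algebroid of a connection *)

Section ConnectionAlgebroid.
Variables (R : realType) (g : lie_crossed_module R).
Variables (M : manifold R) (A : diff_form 1 (smoothSec M (h0 g))).
Variable B : diff_form 2 (smoothSec M (h1 g)).
Implicit Types (X Y Z : vectorField M).
Implicit Types (u v : smoothSec M (h0 g)) (m n : smoothSec M (h1 g)).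

Local Notation F := (curv_of A).
Local Notation D0 := (covd (la_br (h0 g)) A).
Local Notation D1 := (covd (phi g) A).
Local Notation L := (connection_lie2 A B).
Implicit Types (x y z : A0 L).

Let fA : is_form A := formP A.
Let fB : is_form B := formP B.
Let D0P : is_connection D0 := D0_connection A.
Let D1P : is_connection D1 := D1_connection A.
Let fF : is_form F := curv_of_form fA.

(** The bracket of the algebroid of the connection [(A, 0)]. *)
Definition strict_br (x y : A0 L) : A0 L :=
  (lie x.1 y.1, D0 x.1 y.2 - D0 y.1 x.2 + F [tuple x.1; y.1] + fl2_00 x.2 y.2).

Definition B_twist (x y : A0 L) : A1 L := B [tuple x.1; y.1].

Lemma connection_act x (m : A1 L) : l2_01 x m = D1 x.1 m + fl2_01 x.2 m.
Proof. by case: x. Qed.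

Lemma connection_br x y : l2_00 x y = strict_br x y - l1 (B_twist x y).
Proof.
case: x y => [X u] [Y v]; congr (_, _); first by rewrite subr0.
by rewrite fcurvE /B_twist /= /covd; zmod.
Qed.

Lemma connection_l3 x y z : l3 x y z =
  - (l2_01 x (B_twist y z) - l2_01 y (B_twist x z) + l2_01 z (B_twist x y)
     - B_twist (strict_br x y) z - B_twist y (strict_br x z)
     + B_twist x (strict_br y z)).
Proof.
rewrite !connection_act; case: x y z => [X u] [Y v] [Z w] /=.
rewrite curvE ext_d2E // /B_twist /= /fl2_10 (form2C Z X) // /fl2_01 lift2Nr.
by zmod.
Qed.

(** The Leibniz rule; it implies linearity over the constants because these
are killed by vector fields. *)
Lemma strict_br_DZ x (f : smoothFun M) y z :
  strict_br x (f *: y + z)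
  = f *: strict_br x y + x.1 f *: y + strict_br x z.
Proof.
case: x y z => [X u] [Y v] [Z w]; congr (_, _) => /=; first exact: lieDZr.
rewrite (connD D0P) (connM D0P) (conn_vf D0P) form2DZr //.
rewrite /fl2_00 lift2Dr lift2Zr.
(* Distributivity is stated for variables: rewriting with it directly would
   also open the covariant derivatives, which are sums. *)
have fE (p q r s : smoothSec M (h0 g)) :
    f *: (p - q + r + s) = f *: p - f *: q + f *: r + f *: s.
  by rewrite !scalerDr scalerN.
by rewrite fE; zmod.
Qed.

Lemma act_DZl (f : smoothFun M) x y (m : A1 L) :
  l2_01 (f *: x + y) m = f *: l2_01 x m + l2_01 y m.
Proof.
rewrite !connection_act (conn_vf D1P) /fl2_01 lift2Dl lift2Zl [in RHS]scalerDr.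
by zmod.
Qed.

Lemma act_DZr x (f : smoothFun M) (m n : A1 L) :
  l2_01 x (f *: m + n) = f *: l2_01 x m + x.1 f *: m + l2_01 x n.
Proof.
rewrite !connection_act (connD D1P) (connM D1P) /fl2_01 lift2Dr lift2Zr.
by rewrite [in RHS]scalerDr; zmod.
Qed.

Lemma strict_brC x y : strict_br x y = - strict_br y x.
Proof.
case: x y => [X u] [Y v]; congr (_, _) => /=; first exact: lieC.
by rewrite (form2C X Y) // /fl2_00 (brC u); zmod.
Qed.

(** Sorted by degree in [u], [v], [w], the second component combines, from
degree 3 down to 0, the Jacobi identity of [h0], the derivation property of
[D0], the curvature formula and the Bianchi identity. *)
Lemma strict_br_jacobi x y z : strict_br x (strict_br y z)
  = strict_br (strict_br x y) z + strict_br y (strict_br x z).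
Proof.
case: x y z => [X u] [Y v] [Z w]; congr (_, _) => /=; first exact: lie_jacobi.
have ad := @ad_br _ (h0 g).
have Bi := bianchi fA [tuple X; Y; Z]; rewrite ext_d2E // in Bi.
have dL := covd_lift2 ad A; have dC := covd_curvature ad fA.
move: Bi dL dC D0P fF; rewrite /fl2_00.
(* Only the properties of the connection and of its curvature matter from here
   on, and they are kept from being unfolded. *)
move: (covd (la_br (h0 g)) A) (curv_of A) => d f Bi dL dC dP ff.
rewrite !(connD dP, connN dP) !dL !dC !(lift2Dl, lift2Nl, lift2Dr, lift2Nr).
rewrite (br_jacobi u) -[RHS]addr0 -[X in _ = _ + X]Bi.
rewrite !(brC (f _)) !(brC (d _ _)).
by zmod.
Qed.

Lemma fl1_fl2_01 u m : fl1 (fl2_01 u m) = fl2_00 u (fl1 m).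
Proof. by apply: smoothSec_eq => x; rewrite /= psi_phi. Qed.

Lemma fl2_01_fl1C m n : fl2_01 (fl1 m) n = - fl2_01 (fl1 n) m.
Proof.
have e m' n' : fl2_01 (fl1 m') n' = lift2 (la_br (h1 g)) m' n'.
  by apply: smoothSec_eq => x; rewrite /= phi_psi.
by rewrite !e brC.
Qed.

Lemma strict_br_linear x : real_linear (strict_br x).
Proof. by move=> a y z; rewrite strict_br_DZ vf_cst scale0r addr0. Qed.

Lemma act_linear x : real_linear (@l2_01 R M L x).
Proof. by move=> a m n; rewrite act_DZr vf_cst scale0r addr0. Qed.

Lemma l1_fun_linear : fun_linear (@l1 R M L).
Proof.
by move=> f m n; congr (_, _); rewrite /= ?scaler0 ?addr0 // /fl1 lift1D lift1Z.
Qed.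

(** This is [covd_curvature] for the action of [h0] on [h1]. *)
Lemma act_strict_br x y (m : A1 L) :
  l2_01 (strict_br x y) m = l2_01 x (l2_01 y m) - l2_01 y (l2_01 x m).
Proof.
rewrite !connection_act; case: x y => [X u] [Y v] /=.
have dL := covd_lift2 (@phi_br _ g) A.
have dC := covd_curvature (@phi_br _ g) fA.
rewrite /fl2_01 /fl2_00; move: dL dC D0P D1P.
move: (covd (la_br (h0 g)) A) (covd (phi g) A) (curv_of A).
move=> d d1 f dL dC dP d1P.
rewrite !(connD d1P, connN d1P) !dL !dC !(lift2Dl, lift2Nl, lift2Dr, lift2Nr).
by rewrite (lift2_rep (@phi_br _ g)); zmod.
Qed.

Lemma connection_is_lie2_algebra : is_lie2_algebra L.
Proof.
apply: (@twist_is_lie2_algebra _ _ L strict_br B_twist).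
- by move=> a; exact: l1_fun_linear.
- exact: strict_br_linear.
- exact: strict_brC.
- by move=> m a x y; rewrite act_DZl.
- exact: act_linear.
- by move=> x a y z; rewrite /B_twist form2DZr.
- by move=> x y; rewrite /B_twist (form2C x.1 y.1).
- move=> x m; rewrite connection_act /strict_br /= lie0r (conn0l D0P).
  by rewrite form2_0r // subr0 addr0 -fl1_covd -fl1_fl2_01 /fl1 lift1D.
- move=> m n; rewrite !connection_act !(conn0l D1P) !add0r.
  exact: fl2_01_fl1C.
- exact: strict_br_jacobi.
- exact: act_strict_br.
- by move=> x m; exact: form2_0r.
- exact: connection_br.
- exact: connection_l3.
Qed.

Lemma connection_l3_linear x y : fun_linear (@l3 R M L x y).
Proof.
case: x y => [X u] [Y v] f [Z w] [Z' w'] /=.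
rewrite form3DZr; last exact: curv_form.
rewrite (form2DZr f Z Z' Y fB) (form2DZl f Z Z' X fB) /fl2_10 /fl2_01.
rewrite !(lift2Dl, lift2Zl, lift2Dr, lift2Zr).
by rewrite !(scalerDr, scalerN); zmod.
Qed.

Lemma connection_is_transitive : is_transitive_lie2_algebroid L.
Proof.
split=> //.
- exact: connection_is_lie2_algebra.
- by move=> X; exists (X, 0).
- exact: l1_fun_linear.
- exact: connection_l3_linear.
- move=> x y f; rewrite !connection_br.
  have -> : B_twist x (f *: y) = f *: B_twist x y.
    exact: (form_consZ (form_contr x.1 fB) f y.1 [tuple]).
  have := strict_br_DZ x f y 0.
  rewrite !addr0 (rlin0 (strict_br_linear x)) addr0 => ->.
  have := l1_fun_linear f (B_twist x y) 0.
  rewrite !addr0 (rlin0 (fun a => l1_fun_linear (scst M a))) addr0 => ->.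
  by rewrite scalerBr; zmod.
- move=> x m f; rewrite -[f *: m]addr0 act_DZr.
  by rewrite (rlin0 (act_linear x)) addr0.
Qed.

End ConnectionAlgebroid.

(** * Perfect pairings and the quadratic structure *)

Section Transpose.
Variables (K : fieldType) (U V : vectType K) (S : 'Hom(U, 'Hom(V, K^o))).

Definition eval_at (v : V) (u : U) : K^o := S u v.

Fact eval_at_linear v : linear (eval_at v).
Proof. by move=> a u u'; rewrite /eval_at linearP add_lfunE scale_lfunE. Qed.
HB.instance Definition _ v :=
  GRing.isLinear.Build K U K^o *:%R (eval_at v) (eval_at_linear v).

Definition transpose_fun (v : V) : 'Hom(U, K^o) := linfun (eval_at v).

Fact transpose_linear : linear transpose_fun.
Proof.
move=> a v v'; apply/lfunP => u.
by rewrite add_lfunE scale_lfunE !lfunE /= /eval_at linearP.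
Qed.
HB.instance Definition _ :=
  GRing.isLinear.Build K V 'Hom(U, K^o) *:%R transpose_fun transpose_linear.

Definition transpose : 'Hom(V, 'Hom(U, K^o)) := linfun transpose_fun.

Lemma transposeE v u : transpose v u = S u v.
Proof. by rewrite lfunE /= lfunE. Qed.

End Transpose.

Lemma injective_dim (K : fieldType) (U W : vectType K) (f : 'Hom(U, W)) :
  (forall u, f u = 0 -> u = 0) -> \dim (limg f) = dim U.
Proof.
move=> f0; rewrite limg_dim_eq ?dimvf // capfv; apply/eqP.
by rewrite -subv0; apply/subvP => u; rewrite memv_ker memv0 => /eqP/f0 ->.
Qed.

(** Nondegeneracy on each side bounds one dimension by the other, so the
injective map [u |-> S u] is also onto. *)
Lemma perfect_pairing (K : fieldType) (U V : vectType K)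
    (S : 'Hom(U, 'Hom(V, K^o))) :
  (forall u, (forall v, S u v = 0) -> u = 0) ->
  (forall v, (forall u, S u v = 0) -> v = 0) ->
  forall l : 'Hom(V, K^o), exists u, S u = l.
Proof.
move=> S0 S1 l.
have dimS : \dim (limg S) = dim U.
  by apply: injective_dim => u Su; apply: S0 => v; rewrite Su lfunE.
have dimT : \dim (limg (transpose S)) = dim V.
  apply: injective_dim => v Tv; apply: S1 => u.
  by rewrite -transposeE Tv lfunE.
have dimH (W : vectType K) : dim 'Hom(W, K^o) = dim W.
  by rewrite /dim /= muln1.
have le1 : (dim V <= dim U)%N.
  by rewrite -dimT -(dimH U) -(dimvf 'Hom(U, K^o)) dimvS // subvf.
have /eqP full : limg S == fullv.
  by rewrite eqEdim subvf dimvf dimH dimS.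
have : l \in limg S by rewrite full memvf.
by case/memv_imgP => u _ ->; exists u.
Qed.

Section Duality.
Variables (R : realType) (M : manifold R) (U V : vectType R).
Variable S : 'Hom(U, 'Hom(V, R^o)).

Lemma fun_linear_sum (E : lmodType (smoothFun M)) (lam : smoothSec M V -> E) s :
  fun_linear lam ->
  lam s = \sum_i sec_coord s i *: lam (csec M (vbasis {:V})`_i).
Proof.
move=> lamP; have lamr : real_linear lam by move=> a; exact: lamP.
rewrite [in LHS](sec_basisE s) (big_morph _ (rlinD lamr) (rlin0 lamr)).
apply: eq_bigr => i _; have := lamP (sec_coord s i) (csec M (vbasis {:V})`_i) 0.
by rewrite addr0 (rlin0 lamr) addr0.
Qed.

(** A linear form [lam] on sections is determined by its values on the constant
basis sections, and is represented by the combination of the dual basis with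
these values as coefficients. *)
Lemma section_perfect :
  (forall u, (forall v, S u v = 0) -> u = 0) ->
  (forall v, (forall u, S u v = 0) -> v = 0) ->
  forall lam : smoothSec M V -> (smoothFun M)^o, fun_linear lam ->
  exists s : smoothSec M U, forall t, lam t = fun_of_sec (lift2 S s t).
Proof.
move=> S0 S1 lam lamP.
have dual i : exists u, forall v, S u v = coord (vbasis {:V}) i v.
  have [u Su] := perfect_pairing S0 S1 (linfun (coord (vbasis {:V}) i)).
  by exists u => v; rewrite Su lfunE.
pose u i := projT1 (cid (dual i)).
have uE i v : S (u i) v = coord (vbasis {:V}) i v.
  exact: (projT2 (cid (dual i))).
exists (\sum_(i < \dim {:V})
          (lam (csec M (vbasis {:V})`_i) : smoothFun M) *: csec M (u i)) => t.
rewrite (fun_linear_sum t lamP) lift2_suml fun_of_sec_sum.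
apply: eq_bigr => i _; rewrite lift2Zl fun_of_secZ lift2_csec.
rewrite (_ : fun_of_sec _ = sec_coord t i); first exact: mulrC.
by apply/val_inj/funext => x; exact: uE.
Qed.

End Duality.

Section Quadratic.
Variables (R : realType) (g : lie_crossed_module R).
Variables (S : 'Hom(h0 g, 'Hom(h1 g, R^o))) (hS : is_quadratic_strict S).
Variables (M : manifold R) (A : diff_form 1 (smoothSec M (h0 g))).
Variable B : diff_form 2 (smoothSec M (h1 g)).
Local Notation L := (connection_lie2 A B).
Local Notation "<[ u , m ]>" := (sec_pairing S u m).
Let SP := @sec_pairing_bilinear _ _ S M.

Lemma connection_is_quadratic :
  is_quadratic_lie2_algebroid (connection_pairing A B S).
Proof.
have fA : is_form A := formP A; have fB : is_form B := formP B.
have [S0 S1 Sl1 Sl2] := hS; rewrite /connection_pairing; split.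
- exact: connection_is_transitive.
- by move=> f [X u] [Y v] m /= _ _; rewrite (bil_l SP).
- by move=> u _ f m n; rewrite (bil_r SP).
- move=> [X u] /= X0 um; rewrite X0; congr (_, _); apply: smoothSec_eq => x.
  apply: S0 => m; have := congr1 (fun f : smoothFun M => f x) (um (csec M m)).
  by [].
- move=> m um; apply: smoothSec_eq => x; apply: S1 => u.
  by have := congr1 (fun f : smoothFun M => f x) (um (0, csec M u) erefl).
- move=> lam lamP; have [s sE] := section_perfect S0 S1 lamP.
  by exists (0, s).
- move=> lam lamP.
  have T0 m : (forall u, transpose S m u = 0) -> m = 0.
    by move=> Sm; apply: S1 => u; rewrite -transposeE.
  have T1 u : (forall m, transpose S m u = 0) -> u = 0.
    by move=> Sm; apply: S0 => m; rewrite -transposeE.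
  have lam0 : fun_linear (fun u => lam (0, u) : (smoothFun M)^o).
    move=> f u v; rewrite -lamP //; congr lam; congr (_, _).
    by rewrite /= scaler0 addr0.
  have [m mE] := section_perfect T0 T1 lam0.
  exists m => -[X u] /= ->; rewrite mE; apply/val_inj/funext => x /=.
  exact: transposeE.
- by move=> m p; exact: (sec_pairing_fl1C hS).
- move=> [X a] [Y u] m /= ->; rewrite -[Lder X m + _]/(covd (phi g) A X m).
  have -> : Lder X u + fl2_00 (A [tuple X]) u - Lder 0 a
      - fl2_00 (A [tuple 0]) a + fcurv A B [tuple X; 0] + fl2_00 a u
      = covd (la_br (h0 g)) A X u + fl2_00 a u.
    rewrite (conn0l (Lder_connection M _)) (form_cons0 fA) /fl2_00 lift20l.
    by rewrite (form2_0r X (fcurv_form A B)) !subr0 addr0.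
  rewrite (vf_sec_pairing hS A) (bilDl SP _ (fl2_00 a u)).
  by rewrite (bilDr SP u _ (fl2_01 a m)) (sec_pairing_br hS); zmod.
- move=> [X a] [Y b] [Z u] [T v] /= -> ->.
  have -> : curv A B [tuple X; Y; 0] = 0.
    exact: (form_cons0 (form_contr Y (form_contr X (curv_form A B))) [tuple]).
  rewrite (form2_0r Y fB) !(form_cons0 fB) /fl2_10 /fl2_01 !lift20r.
  rewrite !oppr0 !addr0 !add0r !(bilNr SP) opprK -(sec_pairing_br hS).
  by rewrite -[RHS]opprK -(sec_pairing_br hS) /fl2_00 [in LHS]brC (bilNl SP).
Qed.
End Quadratic.

(** * The first Pontryagin class *)

Section Classes.
Variables (R : realType) (M : manifold R).

Lemma deRham_class_coboundary k (w : cochain k.+1 (smoothFun M)^o) :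
  is_coboundary w -> deRham_class w = deRham_class (fun=> 0).
Proof.
move=> [p wp]; have DP := derivative_connection M.
have dB (q r : cochain k (smoothFun M)^o) t :
    d_dR (fun s => q s - r s) t = d_dR q t - d_dR r t.
  exact: (ext_dB DP).
apply/seteqP; split=> w' [q w'q] /=.
  exists (DiffForm (form_sub (formP q)
                     (form_sub (@form_zero _ _ _ _) (formP p)))).
  move=> t; rewrite /= !dB [X in X - d_dR p t](ext_d0 DP) sub0r opprK -wp -w'q.
  by rewrite subrK subr0.
exists (DiffForm (form_sub (formP q) (formP p))) => t.
by rewrite /= dB -wp -w'q subr0.
Qed.

End Classes.

Section Pontryagin.
Variables (R : realType) (g : lie_crossed_module R).
Variables (S : 'Hom(h0 g, 'Hom(h1 g, R^o))).
Variables (M : manifold R) (A : diff_form 1 (smoothSec M (h0 g))).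
Variable B : diff_form 2 (smoothSec M (h1 g)).
Local Notation L := (connection_lie2 A B).
Variables (sigma : vectorField M -> A0 L) (sP : is_splitting sigma).
Implicit Types X Y Z : vectorField M.

Lemma sigma_fst X : (sigma X).1 = X.
Proof. exact: (proj2 sP X). Qed.

(** A splitting [X |-> (X, a X)] shifts the connection form [A] by [a]. *)
Definition split_form : cochain 1 (smoothSec M (h0 g)) := fun t =>
  A t + (sigma (thead t)).2.

Lemma split_form_is_form : is_form split_form.
Proof.
have fs : is_form (fun t : 1.-tuple (vectorField M) => (sigma (thead t)).2).
  apply: (form1_of (a := fun X => (sigma X).2)) => f X Y.
  by rewrite (proj1 sP).
have := form_scaleD 1 (formP A) fs.
by congr is_form; apply/funext => t; rewrite scale1r.
Qed.

Definition split_connection := DiffForm split_form_is_form.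
Local Notation A' := split_connection.

Lemma split_formE X : split_form [tuple X] = A [tuple X] + (sigma X).2.
Proof. by []. Qed.

(** The terms in [gamma] cancel, and what remains are the curvatures of the
shifted connection. *)
Lemma R_gammaE gamma t : R_gamma sigma gamma t = (0, - fcurv A' B t).
Proof.
have [X [Y ->]] := tuple2P t; rewrite /R_gamma /R_curv subrK connection_br.
rewrite [LHS]surjective_pairing; congr (_, _); rewrite /= !sigma_fst.
  by rewrite subr0 subrr.
rewrite fcurvE (curv_ofE split_form_is_form) (curv_ofE (formP A)).
rewrite /covd !split_formE /B_twist /fl2_00 !sigma_fst.
rewrite !(connD (Lder_connection M _)) lift2Dl !lift2Dr.
by rewrite (brC (sigma X).2 (A [tuple Y])); zmod.
Qed.

Lemma I_gammaE gamma t : I_gamma sigma gamma t = curv A' B t.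
Proof.
have [X [Y [Z ->]]] := tuple3P t.
have e (m n : A1 L) : - m - n + m = - n by zmod.
rewrite /I_gamma /I_curv e connection_l3 opprK !connection_act.
rewrite /split_connection /B_twist /= !sigma_fst curvE ext_d2E; last first.
  exact: formP.
by rewrite /covd /= !split_formE /fl2_01 !lift2Dl; zmod.
Qed.

(** Independence of the splitting thus becomes a statement on the 5-forms of
all the connections with the same [B]. *)
Lemma pontryagin_formE gamma :
  pontryagin_form (connection_pairing A B S) sigma gamma
  = connection_5form A' B S.
Proof.
apply/funext => t; rewrite /pontryagin_form /connection_5form /wedge.
rewrite -scalerN -sumrN; congr (_ *: _); apply: eq_bigr => s _.
rewrite R_gammaE I_gammaE /connection_pairing /= -scalerN.
by rewrite (bilNl (@sec_pairing_bilinear _ _ S M)).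
Qed.
End Pontryagin.

Theorem theorem6p11 (R : realType)
  (Gamma : strict_lie_2group R) (g : lie_crossed_module R)
  (hg : is_infinitesimal Gamma g)
  (S : 'Hom(h0 g, 'Hom(h1 g, R^o))) (hS : is_quadratic_strict S)
  (M : manifold R)
  (A : diff_form 1 (smoothSec M (h0 g))) (B : diff_form 2 (smoothSec M (h1 g))) :
  [/\ is_quadratic_lie2_algebroid (connection_pairing A B S),
      is_cocycle (connection_5form A B S),
      is_first_pontryagin_class (connection_pairing A B S)
        (deRham_class (connection_5form A B S)) &
      deRham_class (connection_5form A B S) =
      deRham_class (fun=> 0 : (smoothFun M)^o)].
Proof.
have trivial A' : deRham_class (connection_5form A' B S)
    = deRham_class (fun=> 0 : (smoothFun M)^o).
  by apply: deRham_class_coboundary; exact: connection_5form_coboundary.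
split=> //.
- exact: connection_is_quadratic.
- exact: connection_5form_cocycle.
split=> [||sigma gamma sP].
- by exists (connection_5form A B S) => //; exact: connection_5form_cocycle.
- exists (fun X => (X, 0)); split=> // f X Y; congr (_, _).
  by rewrite /= scaler0 addr0.
- rewrite (pontryagin_formE S sP); split; first exact: connection_5form_cocycle.
  by rewrite !trivial.
Qed.
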